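(* Let $0<\alpha\le1$, let $\{\mathcal{S}^\alpha(t)\}_{t\ge0}$ be the generalized fractional Skellam process, and let $\{D_f(t)\}_{t\ge0}$ be an independent Lévy subordinator with $\mathbb{E}(D_f^r(t))<\infty$ for all $r>0$. Then $\mathcal{Z}_f^\alpha(t)=\mathcal{S}^\alpha(D_f(t))$ exhibits overdispersion, that is, $\operatorname{Var}(\mathcal{Z}_f^\alpha(t))-\mathbb{E}(\mathcal{Z}_f^\alpha(t))>0$ for all $t>0$.
   Context: Fix an integer $k\ge1$ and positive rates $\lambda_1,\dots,\lambda_k,\mu_1,\dots,\mu_k$. The generalized counting process (GCP) with rates $\lambda_1,\dots,\lambda_k$ is a Lévy process started at $0$ performing jumps of size $j\in\{1,\dots,k\}$ at rate $\lambda_j$. The generalized Skellam process (GSP) is $\mathcal{S}(t)=M_1(t)-M_2(t)$, with $M_1,M_2$ independent GCPs with rates $\lambda_j$ and $\mu_j$, respectively. For $0<\alpha<1$, the inverse stable subordinator is $Y_\alpha(t)=\inf\{x\ge0: D_\alpha(x)>t\}$, where $D_\alpha$ is the stable subordinator, $\mathbb{E}(e^{-sD_\alpha(t)})=e^{-ts^\alpha}$. The generalized fractional Skellam process (GFSP) is $\mathcal{S}^\alpha(t)=\mathcal{S}(Y_\alpha(t))$ for $0<\alpha<1$ with $\mathcal{S}$ and $Y_\alpha$ independent, and $\mathcal{S}^1(t)=\mathcal{S}(t)$. A Lévy subordinator $\{D_f(t)\}_{t\ge0}$ is a (not identically zero) one-dimensional Lévy process with non-decreasing sample paths, $D_f(0)=0$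 a.s., and $\mathbb{E}(e^{-sD_f(t)})=e^{-tf(s)}$, $s>0$, where $f$ is its Bernštein function. The process $\mathcal{Z}_f^\alpha$ is called the time-changed generalized fractional Skellam process-I (TCGFSP-I). *)

(* Defs.v *)
From HB Require Import structures.
From mathcomp Require Import all_boot all_order all_algebra.
From mathcomp Require Import all_classical all_reals all_analysis.
Set Implicit Arguments.
Unset Strict Implicit.
Unset Printing Implicit Defensive.
Import Order.TTheory GRing.Theory Num.Theory.
Import numFieldNormedType.Exports.
Local Open Scope classical_set_scope.
Local Open Scope ring_scope.

(* A process is a map X : R -> T -> R (time, then outcome).  Only the times
   t >= 0 are meaningful: the values at negative times are unconstrained and
   never used.  Path properties hold for every outcome. *)
Section Processes.
Context {d : measure_display} {T : measurableType d} {R : realType}.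
Implicit Types (P : probability T R) (X Y D M S : R -> T -> R).

Definition cadlag X : Prop := forall (w : T) (t : R), 0 <= t ->
  (X ^~ w @ t^'+ --> X t w) /\ (0 < t -> cvg (X ^~ w @ t^'-)).

(* The product rule is asked for all Borel sets B 0, ..., B n.-1; choosing
   some of them to be setT gives the rule for every subfamily. *)
Definition independent_increments P X : Prop :=
  forall (n : nat) (tau : nat -> R) (B : nat -> set R),
    0 <= tau 0%N -> (forall i, tau i <= tau i.+1) ->
    (forall i, measurable (B i)) ->
    fine (P [set w | forall i, (i < n)%N ->
                       B i (X (tau i.+1) w - X (tau i) w)]) =
    \prod_(i < n) fine (P [set w | B i (X (tau i.+1) w - X (tau i) w)]).

Definition stationary_increments P X : Prop :=
  forall (s h : R) (B : set R), 0 <= s -> 0 <= h -> measurable B ->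
    P [set w | B (X (s + h) w - X s w)] = P [set w | B (X h w)].

Record levy_process P X : Prop := {
  levy_measurable : forall t : R, 0 <= t -> measurable_fun [set: T] (X t) ;
  levy_start : \forall w \ae P, X 0 w = 0 ;
  levy_indep : independent_increments P X ;
  levy_stationary : stationary_increments P X ;
  levy_cadlag : cadlag X }.

Definition process_sigma X : set (set T) :=
  <<s \bigcup_(t in [set t : R | 0 <= t])
        preimage_set_system [set: T] (X t) measurable >>.

Definition independent_processes P X Y : Prop :=
  forall A B : set T, process_sigma X A -> process_sigma Y B ->
    P (A `&` B) = (P A * P B)%E.

(* The jump size j in {1, ..., k} is represented by i : 'I_k with j = i.+1.
   The rates are the infinitesimal ones, as h -> 0+:
     P(M(h) = j) = lambda_j h + o(h),
     P(M(h) = 0) = 1 - (\sum_j lambda_j) h + o(h). *)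
Record is_gcp P (k : nat) (lambda : 'I_k -> R) M : Prop := {
  gcp_levy : levy_process P M ;
  gcp_jump : forall i : 'I_k,
    (fun h : R => fine (P [set w | M h w = i.+1%:R]) / h) @ 0^'+ --> lambda i ;
  gcp_nojump :
    (fun h : R => (1 - fine (P [set w | M h w = 0])) / h) @ 0^'+
      --> \sum_(i < k) lambda i }.

Definition is_gsp P (k : nat) (lambda mu : 'I_k -> R) S : Prop :=
  exists M1 M2 : R -> T -> R,
    [/\ is_gcp P lambda M1, is_gcp P mu M2, independent_processes P M1 M2 &
        forall (t : R) (w : T), 0 <= t -> S t w = M1 t w - M2 t w].

(* As a random time, a subordinator takes its values in [0, +oo). *)
Record levy_subordinator P (f : R -> R) D : Prop := {
  subord_levy : levy_process P D ;
  subord_nondecreasing : forall (w : T) (s t : R),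
    0 <= s -> s <= t -> D s w <= D t w ;
  subord_ge0 : forall (t : R) (w : T), 0 <= t -> 0 <= D t w ;
  subord_nonzero : exists2 t : R, 0 <= t & (0 < P [set w | D t w != 0%R])%E ;
  subord_laplace : forall s t : R, 0 < s -> 0 <= t ->
    'E_P[fun w => expR (- (s * D t w))%R]%E = (expR (- (t * f s)))%:E }.

Definition stable_subordinator P (alpha : R) D : Prop :=
  levy_subordinator P (fun s => s `^ alpha) D.

(* inf set0 = 0; the set is empty only on the null event that D is bounded. *)
Definition first_passage D (t : R) (w : T) : R :=
  inf [set x : R | 0 <= x /\ t < D x w].

Definition time_change X Y (t : R) (w : T) : R := X (Y t w) w.

Definition is_gfsp P (k : nat) (lambda mu : 'I_k -> R) (alpha : R) X : Prop :=
  (alpha = 1 /\ is_gsp P lambda mu X) \/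
  (0 < alpha < 1 /\
   exists S D : R -> T -> R,
     [/\ is_gsp P lambda mu S, stable_subordinator P alpha D,
         independent_processes P S (first_passage D) &
         forall (t : R) (w : T), 0 <= t -> X t w = time_change S (first_passage D) t w]).

End Processes.

(* Main.v *)
Require Import Defs.
From HB Require Import structures.
From mathcomp Require Import all_boot all_order all_algebra.
From mathcomp Require Import all_classical all_reals all_analysis.
From mathcomp Require Import measurable_realfun.
From mathcomp Require Import ring lra.
Set Implicit Arguments.
Unset Strict Implicit.
Unset Printing Implicit Defensive.
Import Order.TTheory GRing.Theory Num.Theory.
Import numFieldNormedType.Exports.
Local Open Scope classical_set_scope.
Local Open Scope ring_scope.

(** Write S for the generalized Skellam process, with E S(u) = m u and
    Var S(u) = v u, where m = \sum_j j (lambda_j - mu_j) and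
    v = \sum_j j^2 (lambda_j + mu_j).  Conditioning on an independent random time
    tau gives E (S(tau) + c)^2 = c^2 + (v + 2 c m) E tau + m^2 E tau^2 for every c.
    Applied first to the inverse stable subordinator, then to D_f(t), this yields
    Var Z - E Z = (v - m) E tau + m^2 Var tau with tau = Y_alpha(D_f(t)), which is
    positive because v > m and E tau > 0.  The cases c = 0 and c = 1 determine both
    moments of Z, so only integrals of nonnegative functions are conditioned.

    Only the infinitesimal rates of a counting process M are given.  Its Laplace
    transform is multiplicative in time and differentiable at 0+, hence
    E exp(-s M(t)) = exp(-t \sum_j lambda_j (1 - exp(-s j))), and the first two
    moments follow by letting s tend to 0 in E (1 - exp(-s M))/s and
    E ((1 - exp(-s M))/s)^2.  The inverse stable time has a finite second moment
    because Y(u) > x forces D(x) <= u, whose probability is at most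
    e E exp(-D(x)/(1+u)). *)

(** * Limits of real sequences *)

Section RealLimits.
Context {R : realType}.

Lemma cvg_sumr (I U : Type) (r : seq I) (F : set_system U) (f : I -> U -> R) (l : I -> R) :
  Filter F -> (forall i, f i @ F --> l i) ->
  \sum_(i <- r) f i x @[x --> F] --> \sum_(i <- r) l i.
Proof.
move=> FF fl; elim: r => [|i r IH].
  by rewrite big_nil; under eq_fun do rewrite big_nil; exact: cvg_cst.
rewrite big_cons; under eq_fun do rewrite big_cons.
by apply: cvgD.
Qed.

Lemma cvg_harmonic_right (t : R) : 0 < t -> t / n.+1%:R @[n --> \oo] --> 0^'+.
Proof.
move=> t0.
have h0 : t / n.+1%:R @[n --> \oo] --> (0 : R).
  by rewrite -[X in _ --> X](mulr0 t); apply: cvgM; [exact: cvg_cst|exact: cvg_harmonic].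
move=> A /h0; apply: (@filterS _ (\oo : set_system nat)) => n; apply.
by rewrite divr_gt0.
Qed.

(** With [h = t / (n+1)] and [q = (1 - phi h) / h], multiplicativity gives
    [phi t = (1 - h q)^(n+1)]. The inequality [1 + x <= exp x], taken at [x = - h q] and at
    [x = h q / (1 - h q)], encloses this power between [exp (- t q / (1 - h q))] and [exp (- t q)],
    which share the limit [exp (- t c)]. *)
Lemma multiplicative_expR (phi : R -> R) (c : R) :
  (forall s t, 0 <= s -> 0 <= t -> phi (s + t) = phi s * phi t) ->
  (forall s, 0 <= s -> 0 <= phi s) ->
  (1 - phi h) / h @[h --> 0^'+] --> c ->
  forall t, 0 < t -> phi t = expR (- (t * c)).
Proof.
move=> phiD phi0 phic t t0.
pose h n : R := t / n.+1%:R.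
have h_gt0 n : 0 < h n by rewrite divr_gt0.
have hN n : n.+1%:R * h n = t by rewrite /h mulrC divfK.
pose q n := (1 - phi (h n)) / h n.
have qc : q n @[n --> \oo] --> c by apply: cvg_comp phic; exact: cvg_harmonic_right.
have phih n : phi (h n) = 1 - h n * q n.
  by rewrite /q mulrC divfK ?gt_eqF// subKr.
have phiX n m : phi (m.+1%:R * h n) = phi (h n) ^+ m.+1.
  elim: m => [|m IH]; first by rewrite mul1r expr1.
  by rewrite exprS -IH -phiD ?mulr_ge0 ?ltW// -natr1 mulrDl mul1r addrC.
have phit n : phi t = (1 - h n * q n) ^+ n.+1 by rewrite -phih -phiX hN.
have hq0 : h n * q n @[n --> \oo] --> (0 : R).
  rewrite -[X in _ --> X](mul0r c); apply: cvgM => //.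
  rewrite -[X in _ --> X](mulr0 t); apply: cvgM; [exact: cvg_cst|exact: cvg_harmonic].
apply/eqP; rewrite eq_le; apply/andP; split.
  have lim : expR (- (t * q n)) @[n --> \oo] --> expR (- (t * c)).
    apply: continuous_cvg; first exact: continuous_expR.
    by apply: cvgN; apply: cvgM => //; exact: cvg_cst.
  apply: (cvgr_to_ge lim).
  apply: nearW => n /=.
  have -> : - (t * q n) = n.+1%:R * - (h n * q n) by rewrite -{1}(hN n); ring.
  rewrite (phit n) expRM_natl lerXn2r ?nnegrE ?expR_ge0//.
  - by rewrite -phih phi0// ltW.
  - by rewrite expR_ge1Dx.
have lim : expR (- (t * q n / (1 - h n * q n))) @[n --> \oo] --> expR (- (t * c)).
  apply: continuous_cvg; first exact: continuous_expR.
  apply: cvgN; rewrite -[X in _ --> X]divr1 -{2}(subr0 1); apply: cvgM.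
    by apply: cvgM => //; exact: cvg_cst.
  by apply: cvgV; [rewrite subr0|apply: cvgB => //; exact: cvg_cst].
apply: (cvgr_to_le lim).
near=> n.
have hq1 : 0 < 1 - h n * q n.
  rewrite subr_gt0; near: n; apply: (cvgr_lt (0:R)) => //.
have -> : - (t * q n / (1 - h n * q n)) =
    n.+1%:R * - (h n * q n / (1 - h n * q n)) by rewrite -{1}(hN n); ring.
rewrite (phit n) expRM_natl lerXn2r ?nnegrE ?expR_ge0//.
  exact: ltW.
rewrite -[leRHS]invrK expRN lef_pV2 ?posrE ?invr_gt0 ?expR_gt0//.
apply: le_trans (expR_ge1Dx _).
by rewrite le_eqVlt; apply/orP; left; apply/eqP; field; rewrite gt_eqF.
Unshelve. all: by end_near. Qed.

End RealLimits.

(** * Independence and random times *)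

Section Independence.
Context {d d1 d2 : measure_display} {T : measurableType d}
  {T1 : measurableType d1} {T2 : measurableType d2} {R : realType}.

(** The joint law agrees with the product of the two laws on rectangles, hence everywhere, and
    Tonelli applies. The targets are arbitrary measurable spaces because one of the variables will
    later be a whole path, represented by the outcome itself. *)
Lemma indep_integral (P : probability T R) (X : T -> T1) (Y : T -> T2)
    (h : T1 * T2 -> \bar R) :
  measurable_fun [set: T] X -> measurable_fun [set: T] Y ->
  (forall A B, measurable A -> measurable B ->
     P (X @^-1` A `&` Y @^-1` B) = (P (X @^-1` A) * P (Y @^-1` B))%E) ->
  measurable_fun setT h -> (forall z, (0 <= h z)%E) ->
  (\int[P]_w h (X w, Y w) = \int[P]_w \int[P]_w' h (X w, Y w'))%E.
Proof.
move=> mX mY indep mh h0.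
have mXY : measurable_fun [set: T] (fun w => (X w, Y w)).
  exact: measurable_fun_pair.
pose X' : {RV P >-> T1} := mfun_Sub (mem_set mX : X \in mfun).
pose Y' : {RV P >-> T2} := mfun_Sub (mem_set mY : Y \in mfun).
pose XY' : {RV P >-> (T1 * T2)%type} :=
  mfun_Sub (mem_set mXY : (fun w => (X w, Y w)) \in mfun).
have -> : (\int[P]_w h (X w, Y w) = \int[distribution P XY']_z h z)%E.
  by rewrite ge0_integral_distribution.
transitivity (\int[distribution P X' \x distribution P Y']_z h z)%E.
  apply: eq_measure_integral => A mA _; apply/esym.
  by apply: product_measure_unique => // B C mB mC; exact: indep.
rewrite fubini_tonelli1// ge0_integral_distribution//; last 2 first.
- exact: measurable_fun_fubini_tonelli_F.
- by move=> x; exact: integral_ge0.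
apply: eq_integral => w _ /=.
rewrite /fubini_F ge0_integral_distribution//.
exact: measurableT_comp.
Qed.

End Independence.

(** * Joint measurability of right-continuous processes *)

Section JointMeasurability.
Context {d : measure_display} {T : measurableType d} {R : realType}.

(* [`|_|] discards the unconstrained values of [X] at negative times. *)
Lemma measurable_right_continuous (X : R -> T -> R) :
  (forall t : R, 0 <= t -> measurable_fun [set: T] (X t)) ->
  (forall w (t : R), 0 <= t -> X ^~ w @ t^'+ --> X t w) ->
  measurable_fun setT (fun z : R * T => X `|z.1| z.2).
Proof.
move=> mX rcX.
(* [r n u] is the first point of the grid of mesh [1 / (n+1)] strictly above [|u|]; strictness is
   what makes right continuity applicable. *)
pose j n (u : R) := Num.truncn (n.+1%:R * `|u|).
pose r n u : R := (j n u).+1%:R / n.+1%:R.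
have rgt n u : `|u| < r n u.
  by rewrite /r ltr_pdivlMr// mulrC; exact: truncnS_gt.
have rle n u : r n u <= `|u| + n.+1%:R^-1.
  rewrite /r -addn1 natrD mulrDl mul1r lerD2r ler_pdivrMr// mulrC.
  by rewrite truncn_le mulr_ge0.
have rcvg u : r n u @[n --> \oo] --> `|u|^'+.
  have rcvg' : r n u @[n --> \oo] --> `|u|.
    apply: (@squeeze_cvgr _ _ _ _ (cst `|u|) (fun n => `|u| + n.+1%:R^-1)).
    - by apply: nearW => n; rewrite rle andbT ltW /=.
    - exact: cvg_cst.
    - rewrite -[X in _ --> X]addr0; apply: cvgD; first exact: cvg_cst.
      exact: cvg_harmonic.
  move=> A /rcvg' rA;  apply: (@filterS _ (\oo : set_system nat)) rA => n; apply; exact: rgt.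
have mj n i : measurable [set z : R * T | j n z.1 = i].
  have -> : [set z : R * T | j n z.1 = i] =
      (fun z => n.+1%:R * `|z.1|) @^-1` `[i%:R, i.+1%:R[.
    apply/seteqP; split => z /=; rewrite in_itv/= -truncn_eq ?mulr_ge0//.
      by move/eqP.
    by move=> /eqP.
  rewrite -[X in measurable X]setTI.
  apply: (_ : measurable_fun setT (fun z : R * T => n.+1%:R * `|z.1|)) => //.
  by apply: measurable_funM => //; exact: measurableT_comp.
apply: (@measurable_fun_cvg _ _ _ setT (fun n (z : R * T) => X (r n z.1) z.2)) => //.
- move=> n _ B mB; rewrite setTI.
  (* The grid index takes countably many values, and on each of its level sets the approximation is
     [X] at a fixed time. *)
  have -> : (fun z : R * T => X (r n z.1) z.2) @^-1` B =
     \bigcup_i ([set z : R * T | j n z.1 = i] `&`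
        (snd @^-1` (X (i.+1%:R / n.+1%:R) @^-1` B))).
    apply/seteqP; split => [z Bz|z [i _ [/= <-]]//].
    by exists (j n z.1).
  apply: bigcupT_measurable => i; apply: measurableI.
    exact: mj.
  rewrite -[X in measurable X]setTI; apply: measurable_snd => //.
  by rewrite -[X in measurable X]setTI; apply: mX.
- move=> z _.
  by apply: (@cvg_comp _ _ _ (r ^~ z.1) (X ^~ z.2)); [exact: rcvg|exact: rcX].
Qed.

Lemma measurable_section_right_continuous (X : R -> T -> R) (g : R -> \bar R) :
  (forall t : R, 0 <= t -> measurable_fun [set: T] (X t)) ->
  (forall w (t : R), 0 <= t -> X ^~ w @ t^'+ --> X t w) ->
  measurable_fun setT g -> measurable_fun setT (fun z : R * T => g (X `|z.1| z.2)).
Proof.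
by move=> mX rcX mg; apply: measurableT_comp => //; exact: measurable_right_continuous.
Qed.

(** By Tonelli. This makes the moments of the inverse stable time Borel functions of time, so that
    they can be evaluated at the random time [D_f(t)]. *)
Lemma measurable_integral_right_continuous (P : probability T R) (X : R -> T -> R)
    (g : R -> \bar R) :
  (forall t : R, 0 <= t -> measurable_fun [set: T] (X t)) ->
  (forall w (t : R), 0 <= t -> X ^~ w @ t^'+ --> X t w) ->
  measurable_fun setT g -> (forall x, (0 <= g x)%E) ->
  measurable_fun setT (fun u : R => \int[P]_w g (X `|u|%R w))%E.
Proof.
move=> mX rcX mg g0.
apply: (@measurable_fun_fubini_tonelli_F _ _ _ T R P (fun z : R * T => g (X `|z.1| z.2))) => //.
exact: (measurable_section_right_continuous mX rcX mg).
Qed.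

End JointMeasurability.

(** * Integration at an independent random time *)

Section TimeChange.
Context {d : measure_display} {T : measurableType d} {R : realType}.
Variables (P : probability T R) (X D : R -> T -> R) (t : R).
Hypotheses (mX : forall t : R, 0 <= t -> measurable_fun [set: T] (X t))
  (rcX : forall w (t : R), 0 <= t -> X ^~ w @ t^'+ --> X t w)
  (t0 : 0 <= t) (mD : measurable_fun [set: T] (D t)) (D0 : forall w, 0 <= D t w).

Lemma measurable_time_change : measurable_fun [set: T] (time_change X D t).
Proof.
have -> : time_change X D t = (fun z : R * T => X `|z.1| z.2) \o (fun w => (D t w, w)).
  by apply/funext => w; rewrite /time_change /= ger0_norm.
apply: measurableT_comp; first exact: measurable_right_continuous.
exact: measurable_fun_pair.
Qed.

Lemma process_sigma_measurable (Y : R -> T -> R) (s : R) (B : set R) :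
  0 <= s -> measurable B -> process_sigma Y (Y s @^-1` B).
Proof.
move=> s0 mB; apply: sub_gen_smallest; exists s => //.
by exists B => //; rewrite setTI.
Qed.

(** The outcome space receives the coarser sigma-algebra generated by [X]. The identity map into it
    carries the whole path, [X] is still jointly measurable for it, and independence of the two
    processes gives independence of [D t] and this map, so [indep_integral] applies. *)
Lemma time_change_integral (g : R -> \bar R) :
  independent_processes P X D ->
  measurable_fun setT g -> (forall x, (0 <= g x)%E) ->
  (\int[P]_w g (time_change X D t w) = \int[P]_w \int[P]_w' g (X (D t w) w'))%E.
Proof.
move=> indep mg g0.
pose G := \bigcup_(t in [set t : R | 0 <= t])
        preimage_set_system [set: T] (X t) measurable.
pose T' := g_sigma_algebraType G.
pose X' : R -> T' -> R := X.
have mX' (s : R) : 0 <= s -> measurable_fun [set: T'] (X' s).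
  move=> s0 _ B mB; rewrite setTI; exact: process_sigma_measurable.
have sub : process_sigma X `<=` measurable.
  apply: smallest_sub; first exact: sigma_algebra_measurable.
  by move=> A [s s0] [B mB <-]; exact: mX.
have midT : measurable_fun [set: T] (id : T -> T').
  by move=> _ B mB; rewrite setTI; exact: sub.
pose h (z : (R * T')%type) : \bar R := g (X' `|z.1| z.2).
transitivity (\int[P]_w h (D t w, w))%E.
  by apply: eq_integral => w _; rewrite /h/= ger0_norm.
rewrite (@indep_integral _ _ _ T R T' R P (D t) (id : T -> T'))//.
- apply: eq_integral => w _; apply: eq_integral => w' _.
  by rewrite /h/= ger0_norm.
- move=> A B mA mB; rewrite preimage_id setIC muleC; apply: indep => //.
  exact: process_sigma_measurable.
- exact: (measurable_section_right_continuous mX' rcX mg).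
- by move=> z; exact: g0.
Qed.

End TimeChange.

(** * Moments from the Laplace transform *)

Section LaplaceMoments.
Context {d : measure_display} {T : measurableType d} {R : realType}.

(* Fatou replaces dominated convergence: [f] need not be integrable a priori. *)
Lemma integral_cvg_minorants (mu : {measure set T -> \bar R}) (g : nat -> T -> R)
    (f : T -> R) (c : nat -> R) (l : R) :
  (forall n, measurable_fun [set: T] (g n)) -> measurable_fun [set: T] f ->
  (forall n w, 0 <= g n w <= f w) -> (forall w, g n w @[n --> \oo] --> f w) ->
  (forall n, (\int[mu]_w (g n w)%:E = (c n)%:E)%E) -> c n @[n --> \oo] --> l ->
  (\int[mu]_w (f w)%:E = l%:E)%E.
Proof.
move=> mg mf gf glim intg cl.
have cl' : (c n)%:E @[n --> \oo] --> l%:E by apply: cvg_EFin => //; exact: nearW.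
apply/eqP; rewrite eq_le; apply/andP; split.
  have -> : (\int[mu]_w (f w)%:E = \int[mu]_w limn_einf (fun n => (g n w)%:E))%E.
    apply: eq_integral => w _; rewrite (cvg_limn_einf_sup (l := (f w)%:E))//.
    by apply: cvg_EFin (glim w); exact: nearW.
  have := @fatou _ _ _ mu setT measurableT (fun n w => (g n w)%:E).
  rewrite (_ : (fun n => \int[mu]_w (g n w)%:E)%E = (fun n => (c n)%:E)); last first.
    exact/funext.
  rewrite (cvg_limn_einf_sup cl'); apply; first by move=> n; exact/measurable_EFinP.
  by move=> n w _; rewrite lee_fin; case/andP: (gf n w).
apply: (cvge_to_le cl'); apply: nearW => n; rewrite -intg.
apply: ge0_le_integral => //=.
- by move=> w _; rewrite lee_fin; case/andP: (gf n w).
- exact/measurable_EFinP.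
- exact/measurable_EFinP.
- by move=> w _; rewrite lee_fin; case/andP: (gf n w).
Qed.

Lemma integral_affine2 (P : probability T R) (f g : T -> R) (a b c0 c1 c2 : R) :
  f \in Lfun P 1 -> g \in Lfun P 1 ->
  (\int[P]_w (f w)%:E = a%:E)%E -> (\int[P]_w (g w)%:E = b%:E)%E ->
  (\int[P]_w (c0 + c1 * f w + c2 * g w)%:E = (c0 + c1 * a + c2 * b)%:E)%E.
Proof.
move=> fL gL intf intg.
have -> : (fun w => (c0 + c1 * f w + c2 * g w)%:E) =
    EFin \o ((cst c0 \+ (c1 \o* f)) \+ (c2 \o* g)).
  by apply/funext => w /=; rewrite (mulrC c1) (mulrC c2).
have fL' : c1 \o* f \in Lfun P 1 by exact: Lfun_scale.
have gL' : c2 \o* g \in Lfun P 1 by exact: Lfun_scale.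
have cL : cst c0 \in Lfun P 1 by exact: Lfun_cst.
have /= := @expectationD _ _ _ P (cst c0 \+ (c1 \o* f)) _ (rpredD cL fL') gL'.
rewrite (expectationD cL fL') expectation_cst !expectationZl// unlock intf intg.
by move=> ->.
Qed.

Lemma Lfun1_bounded (P : probability T R) (f : T -> R) (M : R) :
  measurable_fun [set: T] f -> (forall w, `|f w| <= M) -> f \in Lfun P 1.
Proof.
move=> mf fM; apply/Lfun1_integrable; apply: measurable_bounded_integrable => //.
- by rewrite ltey_eq fin_num_measure.
- by exists M; split; rewrite ?num_real // => x Mx w _; exact: le_trans (fM w) (ltW Mx).
Qed.

(** Since [y = (y / s) s] tends to 0, the enclosure [y exp (- y) <= 1 - exp (- y) <= y], divided by
    [s], settles the limit. *)
Lemma cvg_1Bexp (y s : nat -> R) (c : R) : (forall n, 0 < s n) ->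
  s n @[n --> \oo] --> 0 -> y n / s n @[n --> \oo] --> c ->
  (1 - expR (- y n)) / s n @[n --> \oo] --> c.
Proof.
move=> s0 slim yc.
have y0 : y n @[n --> \oo] --> (0 : R).
  have -> : y = (fun n => y n / s n * s n) by apply/funext => n; rewrite divfK ?gt_eqF.
  by rewrite -[X in _ --> X](mulr0 c); apply: cvgM.
apply: (@squeeze_cvgr _ _ _ _ (fun n => expR (- y n) * (y n / s n)) (fun n => y n / s n)) => //.
  apply: nearW => n; rewrite mulrA !ler_pM2r ?invr_gt0//; apply/andP; split.
    rewrite -(ler_pM2l (expR_gt0 (y n))) mulrA -expRD subrr expR0 mul1r mulrBr mulr1.
    by rewrite -expRD subrr expR0 lerBrDl expR_ge1Dx.
  by rewrite lerBlDr -lerBlDl expR_ge1Dx.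
rewrite -[X in _ --> X]mul1r -expR0 -oppr0; apply: cvgM => //.
by apply: continuous_cvg; [exact: continuous_expR|exact: cvgN].
Qed.

(** The quotient [(1 - exp (- s X)) / s] lies between 0 and [X] and tends to [X] as [s] tends to 0,
    so both moments are limits of expressions in [G s] and [G (2 s)]. The two assumed limits are
    finite-difference forms of [G'(0)] and [- G''(0)], that is, of the mean and the variance. *)
Lemma laplace_moments (P : probability T R) (X : T -> R) (G : R -> R) (m v : R) :
  measurable_fun [set: T] X -> (forall w, 0 <= X w) ->
  (forall s : R, 0 < s -> (\int[P]_w (expR (- (s * X w)))%:E = (expR (- G s))%:E)%E) ->
  G n.+1%:R^-1 * n.+1%:R @[n --> \oo] --> m ->
  (2 * G n.+1%:R^-1 - G (2 * n.+1%:R^-1)) * n.+1%:R ^+ 2 @[n --> \oo] --> v ->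
  (\int[P]_w (X w)%:E = m%:E)%E /\ (\int[P]_w (X w ^+ 2)%:E = (v + m ^+ 2)%:E)%E.
Proof.
move=> mX X0 lap limm limv.
pose s n : R := n.+1%:R^-1.
have s0 n : 0 < s n by rewrite invr_gt0.
have sV n : n.+1%:R = (s n)^-1 by rewrite invrK.
have slim : s n @[n --> \oo] --> 0 by exact: cvg_harmonic.
have e0 c w : 0 < c -> 0 <= expR (- (c * X w)) <= 1.
  move=> c0; rewrite expR_ge0 -expR0 ler_expR oppr_le0 mulr_ge0// ltW//.
have mE c : measurable_fun setT (fun w => expR (- (c * X w))).
  apply: measurableT_comp; first exact: measurable_expR.
  by apply: measurableT_comp => //; exact: measurable_funM.
have eL c : 0 < c -> (fun w => expR (- (c * X w))) \in Lfun P 1.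
  move=> c0; apply: (@Lfun1_bounded _ _ 1) => // w.
  by have /andP[? ?] := e0 c w c0; rewrite ger0_norm.
pose g n w := (1 - expR (- (s n * X w))) / s n.
have glim w : g n w @[n --> \oo] --> X w.
  apply: cvg_1Bexp => //.
  have -> : (fun n => s n * X w / s n) = cst (X w).
    by apply/funext => n /=; rewrite mulrAC divff ?mul1r// gt_eqF.
  exact: cvg_cst.
have gb n w : 0 <= g n w <= X w.
  have /andP[_ ?] := e0 _ w (s0 n).
  apply/andP; split; first by rewrite divr_ge0 ?subr_ge0// ltW.
  rewrite /g ler_pdivrMr// lerBlDr -lerBlDl mulrC.
  exact: expR_ge1Dx.
have mg n : measurable_fun setT (g n).
  by apply: measurable_funM => //; exact: measurable_funB.
have limm1 : (1 - expR (- G (s n))) / s n @[n --> \oo] --> m.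
  apply: cvg_1Bexp => //.
  by under eq_fun do rewrite -sV.
split.
  apply: (integral_cvg_minorants mg mX gb glim (c := fun n => (1 - expR (- G (s n))) / s n)) => //.
  move=> n.
  have := @integral_affine2 P _ _ _ _ (s n)^-1 (- (s n)^-1) 0 (eL _ (s0 n)) (eL _ (s0 n))
    (lap _ (s0 n)) (lap _ (s0 n)).
  rewrite (_ : _ + _ * _ + _ = (1 - expR (- G (s n))) / s n); last by ring.
  by move=> <-; apply: eq_integral => w _; rewrite /g; congr EFin; ring.
have s20 n : 0 < 2 * s n by rewrite mulr_gt0.
apply: (integral_cvg_minorants (g := fun n w => g n w ^+ 2)
  (c := fun n => (1 - 2 * expR (- G (s n)) + expR (- G (2 * s n))) / s n ^+ 2)) => //.
- by move=> n; exact: measurable_funX.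
- exact: measurable_funX.
- move=> n w; have /andP[? ?] := gb n w; rewrite exprn_ge0//=.
  by rewrite lerXn2r ?nnegrE//.
- move=> w; under eq_fun do rewrite expr2; rewrite expr2; exact: cvgM.
- move=> n.
  have := @integral_affine2 P _ _ _ _ ((s n)^-2) (- 2 * (s n)^-2) ((s n)^-2) (eL _ (s0 n)) (eL _ (s20 n))
    (lap _ (s0 n)) (lap _ (s20 n)).
  rewrite (_ : _ + _ * _ + _ = (1 - 2 * expR (- G (s n)) + expR (- G (2 * s n))) / s n ^+ 2); last by ring.
  move=> <-; apply: eq_integral => w _; rewrite /g; congr EFin.
  have -> : - (2 * s n * X w) = - (s n * X w) + - (s n * X w) by ring.
  by rewrite expRD exprMn exprVn; ring.
(* The second difference splits into a term tending to the variance [v] and the square of the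
   first-order quotient, which tends to [m ^+ 2]. *)
have -> : (fun n => (1 - 2 * expR (- G (s n)) + expR (- G (2 * s n))) / s n ^+ 2) =
   (fun n => expR (- G (2 * s n)) * ((1 - expR (- (2 * G (s n) - G (2 * s n)))) / s n ^+ 2)
     + ((1 - expR (- G (s n))) / s n) * ((1 - expR (- G (s n))) / s n)).
  apply/funext => n.
  rewrite (mulrA (expR _)) mulrBr mulr1 -expRD.
  have -> : - G (2 * s n) + - (2 * G (s n) - G (2 * s n)) = - G (s n) + - G (s n) by ring.
  by rewrite expRD; field; rewrite gt_eqF.
have limv1 : (2 * G (s n) - G (2 * s n)) / s n ^+ 2 @[n --> \oo] --> v.
  by under eq_fun do rewrite -exprVn -sV.
have s2lim : s n ^+ 2 @[n --> \oo] --> (0 : R).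
  by have := cvgM slim slim; rewrite mulr0; apply.
(* A quotient with a finite limit and a vanishing denominator has a vanishing numerator; this yields
   that [G (s n)] and [G (2 * s n)] tend to 0. *)
have vanish (u w : nat -> R) (c : R) : (forall n, 0 < w n) -> w n @[n --> \oo] --> (0 : R) ->
    u n / w n @[n --> \oo] --> c -> u n @[n --> \oo] --> (0 : R).
  move=> w0 wlim uc.
  have -> : u = (fun n => u n / w n * w n) by apply/funext => n; rewrite divfK ?gt_eqF.
  by rewrite -[X in _ --> X](mulr0 c); exact: cvgM.
have G0 : G (s n) @[n --> \oo] --> (0 : R).
  apply: (vanish _ s m) => //; by under eq_fun do rewrite -sV.
have G20 : G (2 * s n) @[n --> \oo] --> (0 : R).
  have -> : (fun n => G (2 * s n)) =
      (fun n => 2 * G (s n) - (2 * G (s n) - G (2 * s n))) by apply/funext => n; ring.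
  rewrite -[X in _ --> X](subr0 (0 : R)) -{1}(mulr0 (2 : R)); apply: cvgB.
    by apply: cvgM => //; exact: cvg_cst.
  by apply: (vanish _ (fun n => s n ^+ 2) v) => // n; rewrite exprn_gt0.
rewrite expr2; apply: cvgD; last exact: cvgM.
rewrite -[X in _ --> X]mul1r; apply: cvgM.
  rewrite -[X in _ --> X]expR0 -[in X in _ --> X]oppr0; apply: continuous_cvg; first exact: continuous_expR.
  exact: (cvgN G20).
by apply: cvg_1Bexp => // n; rewrite exprn_gt0.
Qed.

End LaplaceMoments.

(** * Increments of a Lévy process *)

Section LevyProcesses.
Context {d : measure_display} {T : measurableType d} {R : realType}.
Variable P : probability T R.

Lemma eq_distribution_integral (X Y : T -> R) (g : R -> \bar R) :
  measurable_fun [set: T] X -> measurable_fun [set: T] Y ->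
  (forall B, measurable B -> P (X @^-1` B) = P (Y @^-1` B)) ->
  measurable_fun setT g -> (forall x, 0 <= g x)%E ->
  (\int[P]_w g (X w) = \int[P]_w g (Y w))%E.
Proof.
move=> mX mY XY mg g0.
pose X' : {RV P >-> R} := mfun_Sub (mem_set mX : X \in mfun).
pose Y' : {RV P >-> R} := mfun_Sub (mem_set mY : Y \in mfun).
transitivity (\int[distribution P X']_x g x)%E; first by rewrite ge0_integral_distribution.
transitivity (\int[distribution P Y']_x g x)%E; last by rewrite ge0_integral_distribution.
by apply: eq_measure_integral => A mA _; exact: XY.
Qed.

(** Independence of the two increments over [0 <= s <= s + t] factors the integral, and stationarity
    then replaces each increment by the process at the length of its interval. The first increment
    keeps [M 0], which vanishes only almost surely. *)
Lemma levy_increments_integral (M : R -> T -> R) (s t : R) (g1 g2 : R -> R) :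
  levy_process P M -> 0 <= s -> 0 <= t ->
  measurable_fun setT g1 -> measurable_fun setT g2 ->
  (forall x, 0 <= g1 x) -> (forall x, 0 <= g2 x) ->
  (\int[P]_w (g1 (M s w - M 0 w) * g2 (M (s + t)%R w - M s w))%:E =
   (\int[P]_w (g1 (M s w))%:E) * \int[P]_w (g2 (M t w))%:E)%E.
Proof.
move=> LM s0 t0 mg1 mg2 g10 g20.
have mM (u : R) : 0 <= u -> measurable_fun [set: T] (M u) by move=> u0; exact: (levy_measurable LM u0).
have st0 : 0 <= s + t by exact: addr_ge0.
have mX : measurable_fun [set: T] (fun w => M s w - M 0 w).
  by apply: measurable_funB; exact: mM.
have mY : measurable_fun [set: T] (fun w => M (s + t) w - M s w).
  by apply: measurable_funB; exact: mM.
have mh : measurable_fun setT (fun z : R * R => (g1 z.1 * g2 z.2)%:E).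
  by apply/measurable_EFinP; apply: measurable_funM; exact: measurableT_comp.
rewrite (indep_integral (h := fun z : R * R => (g1 z.1 * g2 z.2)%:E) mX mY)//; last 2 first.
- move=> A B mA mB.
  (* The times are [0, s, s + t] and then stay constant, since [tau] must be nondecreasing over all
     of [nat]. *)
  pose tau (i : nat) : R := if i is i'.+1 then (if i' is 0%N then s else s + t) else 0.
  pose C (i : nat) : set R := if i is 0%N then A else B.
  have := @levy_indep _ _ _ _ _ LM 2 tau C (lexx _).
  have mpre (Z : T -> R) (E : set R) : measurable_fun [set: T] Z -> measurable E ->
      measurable (Z @^-1` E).
    by move=> mZ mE; rewrite -[X in measurable X]setTI; exact: mZ.
  have -> : [set w | forall i, (i < 2)%N -> C i (M (tau i.+1) w - M (tau i) w)] =
     (fun w => M s w - M 0 w) @^-1` A `&` (fun w => M (s + t) w - M s w) @^-1` B.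
    apply/seteqP; split=> [w h|w [h0 h1] [|[|//]]//].
    by split; [exact: (h 0%N)|exact: (h 1%N)].
  rewrite big_ord_recl big_ord1 /=.
  have mI : measurable ((fun w => M s w - M 0 w) @^-1` A `&`
      (fun w => M (s + t) w - M s w) @^-1` B) by apply: measurableI; exact: mpre.
  rewrite -[X in _ -> X = _]fineK ?fin_num_measure// => ->.
  - by rewrite EFinM !fineK ?fin_num_measure//; exact: mpre.
  - by move=> [|[|i]] //=; rewrite lerDl.
  - by move=> [|i].
- by move=> z; rewrite lee_fin mulr_ge0.
transitivity (\int[P]_w ((g1 (M s w - M 0 w))%:E *
    \int[P]_w' (g2 (M (s + t)%R w' - M s w'))%:E))%E.
  apply: eq_integral => w _; rewrite /= -ge0_integralZl_EFin//.
  - by move=> w' _; rewrite lee_fin.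
  - by apply/measurable_EFinP; exact: measurableT_comp.
rewrite ge0_integralZr//; last 3 first.
- by apply/measurable_EFinP; exact: measurableT_comp.
- by move=> w _; rewrite lee_fin.
- by apply: integral_ge0 => w _; rewrite lee_fin.
congr (_ * _)%E.
  apply: (eq_distribution_integral (g := EFin \o g1) mX (mM _ s0)).
  - by move=> B mB; have := levy_stationary LM (lexx 0) s0 mB; rewrite add0r.
  - exact/measurable_EFinP.
  - by move=> x; rewrite lee_fin.
apply: (eq_distribution_integral (g := EFin \o g2) mY (mM _ t0)).
- by move=> B mB; exact: (levy_stationary LM s0 t0 mB).
- exact/measurable_EFinP.
- by move=> x; rewrite lee_fin.
Qed.

End LevyProcesses.

(** * Generalized counting and Skellam processes *)

Section GCP.
Context {d : measure_display} {T : measurableType d} {R : realType}.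
Variable P : probability T R.

Lemma measurable_preimage (X : T -> R) (B : set R) :
  measurable_fun [set: T] X -> measurable B -> measurable [set w | B (X w)].
Proof. by move=> mX mB; rewrite -[X in measurable X]setTI; exact: mX. Qed.

(** The events [X = j] are disjoint, so the sum of their indicators weighted by [g j] never exceeds
    [g X]. This turns information on infinitesimal rates into bounds on expectations. *)
Lemma atoms_le_integral (X : T -> R) (g : R -> R) (n : nat) :
  measurable_fun [set: T] X -> measurable_fun setT g -> (forall x, 0 <= g x) ->
  ((\sum_(j < n) g j%:R * fine (P [set w | X w = j%:R]))%:E <=
   \int[P]_w (g (X w))%:E)%E.
Proof.
move=> mX mg g0.
pose A (j : 'I_n) := [set w | X w = j%:R].
have mA j : measurable (A j) by exact: (measurable_preimage mX (measurable_set1 j%:R)).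
have -> : ((\sum_(j < n) g j%:R * fine (P (A j)))%:E =
    \int[P]_w \sum_(j < n) (g j%:R * \1_(A j) w)%:E)%E.
  rewrite ge0_integral_sum//.
  - rewrite -sumEFin; apply: eq_bigr => j _.
    rewrite (@integralZl_indic _ _ _ P setT measurableT (fun=> A j))//.
      by rewrite integral_indic// setIT EFinM fineK ?fin_num_measure.
    by move=> gj; have := g0 j%:R; rewrite leNgt gj.
  - by move=> j; apply/measurable_EFinP; apply: measurable_funM => //; exact: measurable_indic.
  - by move=> j w _; rewrite lee_fin mulr_ge0.
apply: ge0_le_integral => //.
- by move=> w _; rewrite sume_ge0// => j _; rewrite lee_fin mulr_ge0.
- apply: emeasurable_sum => j.
  by apply/measurable_EFinP; apply: measurable_funM => //; exact: measurable_indic.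
- by apply/measurable_EFinP; exact: measurableT_comp.
move=> w _; rewrite sumEFin lee_fin.
have [[j Xj]|nX] := pselect (exists j : 'I_n, X w = j%:R).
  rewrite (bigD1 j)//= big1 ?addr0.
    by rewrite indicE mem_set// mulr1 Xj.
  move=> i ij; rewrite indicE memNset ?mulr0// /A /= Xj => /eqP.
  by rewrite eqr_nat eq_sym => /eqP/ord_inj/eqP; rewrite (negbTE ij).
rewrite big1 // => j _; rewrite indicE memNset ?mulr0// /A /= => Xj.
by apply: nX; exists j.
Qed.

Variables (k : nat) (lambda : 'I_k -> R) (M : R -> T -> R).
Hypothesis HM : is_gcp P lambda M.

Let LM : levy_process P M := gcp_levy HM.
Let mM (u : R) (u0 : 0 <= u) : measurable_fun [set: T] (M u) := levy_measurable LM u0.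

Lemma gcp_atoms_le (h : R) (g : R -> R) (a : R) : 0 <= h ->
  measurable_fun setT g -> (forall x, 0 <= g x) ->
  (\int[P]_w (g (M h w))%:E = a%:E)%E ->
  g 0 * fine (P [set w | M h w = 0]) +
  \sum_(i < k) g i.+1%:R * fine (P [set w | M h w = i.+1%:R]) <= a.
Proof.
move=> h0 mg g0 ga; have := atoms_le_integral k.+1 (mM h0) mg g0.
by rewrite ga lee_fin big_ord_recl /=.
Qed.

(** Let [rho u] be the probability of [0 <= M u]. Two nonnegative increments have a nonnegative sum,
    so [rho u * rho v <= rho (u + v)] and [1 - rho t <= (n+1) (1 - rho (t / (n+1)))]. The right side
    tends to 0 because [1 - rho h] is [o(h)]. *)
Lemma gcp_ge0_ae (t : R) : 0 <= t -> \forall w \ae P, 0 <= M t w.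
Proof.
rewrite le_eqVlt => /predU1P[<-|t0].
  by apply: filterS (levy_start LM) => w ->.
pose rho u := fine (P [set w | 0 <= M u w]).
have mge0 (u : R) : 0 <= u -> measurable [set w | 0 <= M u w].
  move=> u0; have := measurable_preimage (mM u0) (measurable_itv `[0, +oo[).
  by congr measurable; apply/seteqP; split => w /=; rewrite in_itv/= andbT.
pose g : R -> R := \1_`[0, +oo[.
have mg : measurable_fun setT g by exact: measurable_indic.
have g0 x : 0 <= g x by [].
have gE x : g x = (0 <= x)%R%:R.
  by rewrite /g indicE mem_setE in_itv/= andbT.
have intg u : 0 <= u -> (\int[P]_w (g (M u w))%:E = (rho u)%:E)%E.
  move=> u0; rewrite /rho fineK ?fin_num_measure//; last exact: mge0.
  rewrite -[X in _ = P X]setIT -integral_indic//; last exact: mge0.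
  by apply: eq_integral => w _; rewrite gE indicE mem_setE.
have rho1 u : 0 <= u -> 0 <= rho u <= 1.
  move=> u0; rewrite /rho fine_ge0//= -lee_fin fineK ?fin_num_measure//; last exact: mge0.
  by apply: probability_le1; exact: mge0.
have rhoD u v : 0 <= u -> 0 <= v -> rho u * rho v <= rho (u + v).
  move=> u0 v0; have uv0 := addr_ge0 u0 v0.
  rewrite -lee_fin EFinM -!intg// -(levy_increments_integral LM)//.
  apply: ae_ge0_le_integral => //.
  - by move=> w _; rewrite lee_fin mulr_ge0.
  - apply/measurable_EFinP; apply: measurable_funM; apply: measurableT_comp => //;
      by apply: measurable_funB; apply: mM.
  - by move=> w _; rewrite lee_fin.
  - by apply/measurable_EFinP; apply: measurableT_comp => //; exact: mM.
  apply: filterS (levy_start LM) => w M0 _; rewrite lee_fin M0 subr0 !gE.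
  case: (leP 0 (M u w)) => Mu; last by rewrite mul0r.
  case: (leP 0 (M (u + v) w - M u w)) => Mv; last by rewrite mulr0.
  by rewrite subr_ge0 in Mv; rewrite (le_trans Mu Mv) mulr1.
have rhoN u n : 0 <= u -> 1 - rho (n.+1%:R * u) <= n.+1%:R * (1 - rho u).
  move=> u0; elim: n => [|n IH]; first by rewrite !mul1r.
  have nu0 : 0 <= n.+1%:R * u by rewrite mulr_ge0.
  have /andP[? ?] := rho1 _ u0; have /andP[? ?] := rho1 _ nu0.
  rewrite -(natr1 n.+1) !mulrDl !mul1r.
  have := rhoD _ _ nu0 u0; nra.
have q0 : (1 - rho h) / h @[h --> 0^'+] --> (0 : R).
  (* The rates of the jumps [1, ..., k] add up to the rate of leaving 0, so the mass off the atoms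
     [0, ..., k] is [o(h)]. *)
  have ub : (1 - fine (P [set w | M h w = 0])) / h -
     \sum_(i < k) fine (P [set w | M h w = i.+1%:R]) / h @[h --> 0^'+] --> (0 : R).
    rewrite -[X in _ --> X](subrr (\sum_(i < k) lambda i)); apply: cvgB; first exact: (gcp_nojump HM).
    apply: cvg_sumr => i; exact: (gcp_jump HM).
  apply: (squeeze_cvgr _ (cvg_cst 0) ub); near=> h.
  have h0 : 0 < h by near: h; exact: nbhs_right_gt.
  have /andP[_ rho_1] := rho1 _ (ltW h0).
  apply/andP; split; first by rewrite divr_ge0 ?subr_ge0// ltW.
  rewrite -mulr_suml -mulrBl ler_pM2r ?invr_gt0//.
  have := gcp_atoms_le (ltW h0) mg g0 (intg _ (ltW h0)).
  rewrite gE lexx mul1r; under eq_bigr do rewrite gE ler0n mul1r.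
  lra.
have rhot : 1 - rho t <= 0.
  have lim : t * ((1 - rho (t / n.+1%:R)) / (t / n.+1%:R)) @[n --> \oo] --> t * 0.
    apply: cvgM; first exact: cvg_cst.
    exact: (cvg_comp _ _ (cvg_harmonic_right t0) q0).
  rewrite -(mulr0 t); apply: (cvgr_to_ge lim); apply: nearW => n.
  have := rhoN (t / n.+1%:R) n (ltW (divr_gt0 t0 (ltr0Sn _ _))).
  rewrite mulrCA divff// mulr1; move/le_trans; apply.
  rewrite le_eqVlt; apply/orP; left; apply/eqP; field.
  by rewrite (gt_eqF t0) nat1r pnatr_eq0.
exists (~` [set w | 0 <= M t w]); split => //.
- by apply: measurableC; apply: mge0; exact: ltW.
- rewrite probability_setC; last by apply: mge0; exact: ltW.
  have /andP[_ rho_1] := rho1 _ (ltW t0).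
  have rho1E : rho t = 1 by apply/eqP; rewrite eq_le rho_1/=; lra.
  rewrite -[P _]fineK ?fin_num_measure//; last by apply: mge0; exact: ltW.
  by rewrite -/(rho t) rho1E subee.
Unshelve. all: by end_near. Qed.

(** The absolute value keeps the integrand at most 1 for every outcome and changes nothing almost
    surely. It remains to differentiate at 0+: the atom bound applied to [1 - e] and to [e] encloses
    [(1 - phi h) / h] between two quantities with the same limit. *)
Lemma gcp_laplace (s t : R) : 0 < s -> 0 < t ->
  (\int[P]_w (expR (- (s * `|M t w|)))%:E =
   (expR (- (t * \sum_(i < k) lambda i * (1 - expR (- (s * i.+1%:R))))))%:E)%E.
Proof.
move=> s0 t0.
pose e (x : R) := expR (- (s * `|x|)).
have e0 x : 0 <= e x by exact: expR_ge0.
have e1 x : e x <= 1.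
  by rewrite /e -expR0 ler_expR oppr_le0 mulr_ge0// ltW.
have e00 : e 0 = 1 by rewrite /e normr0 mulr0 oppr0 expR0.
have me : measurable_fun setT e.
  apply: measurableT_comp; first exact: measurable_expR.
  apply: measurableT_comp => //; exact: measurable_funM.
have eL u : 0 <= u -> (fun w => e (M u w)) \in Lfun P 1.
  move=> u0; apply: (@Lfun1_bounded _ _ _ _ _ 1) => [|w].
    exact: (measurableT_comp me (mM u0)).
  by rewrite ger0_norm.
pose phi u := fine (\int[P]_w (e (M u w))%:E).
have phiE u : 0 <= u -> (\int[P]_w (e (M u w))%:E = (phi u)%:E)%E.
  move=> u0; rewrite /phi fineK//.
  by have := expectation_fin_num (eL u u0); rewrite unlock.
have phi0 u : 0 <= u -> 0 <= phi u.
  by move=> u0; apply: fine_ge0; apply: integral_ge0 => w _; rewrite lee_fin.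
have phiD u v : 0 <= u -> 0 <= v -> phi (u + v) = phi u * phi v.
  move=> u0 v0; have uv0 := addr_ge0 u0 v0.
  apply: EFin_inj; rewrite EFinM -!phiE// -(levy_increments_integral LM)//.
  have mXY (a b : R) : 0 <= a -> 0 <= b -> measurable_fun setT (fun w => M a w - M b w).
    by move=> a0 b0; apply: measurable_funB; exact: mM.
  apply: ge0_ae_eq_integral => //.
  - by apply/measurable_EFinP; exact: (measurableT_comp me (mM uv0)).
  - apply/measurable_EFinP; apply: measurable_funM.
      exact: (measurableT_comp me (mXY _ _ u0 (lexx 0))).
    exact: (measurableT_comp me (mXY _ _ uv0 u0)).
  - by move=> w _; rewrite lee_fin.
  - by move=> w _; rewrite lee_fin mulr_ge0.
  (* By stationarity the increment has the law of [M v], which is almost surely nonnegative. *)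
  have incr_ge0 : \forall w \ae P, 0 <= M (u + v) w - M u w.
    exists [set w | M (u + v) w - M u w < 0].
    have mneg := @measurable_itv R `]-oo, 0[.
    have Eneg (Z : T -> R) : [set w | Z w < 0] = [set w | `]-oo, 0[%classic (Z w)].
      by apply/seteqP; split => w /=; rewrite in_itv.
    split.
    - rewrite Eneg; exact: (measurable_preimage (mXY _ _ uv0 u0) mneg).
    - rewrite Eneg (levy_stationary LM u0 v0 mneg) -Eneg.
      have [N [mN PN0 subN]] := gcp_ge0_ae v0.
      apply/eqP; rewrite eq_le measure_ge0 andbT -PN0; apply: le_measure.
      + rewrite inE Eneg; exact: (measurable_preimage (mM v0) mneg).
      + by rewrite inE.
      + by move=> w /= Mw; apply: subN => /=; apply/negP; rewrite -ltNge.
    - by move=> w /= /negP; rewrite -ltNge.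
  apply: filterS3 (levy_start LM) (gcp_ge0_ae u0) incr_ge0 => w M0 Mu Muv _.
  rewrite M0 subr0 /e -expRD; congr (expR _)%:E.
  rewrite (ger0_norm Mu) (ger0_norm Muv) ger0_norm; first by ring.
  by rewrite subr_ge0 in Muv; exact: le_trans Muv.
rewrite (phiE t (ltW t0)); congr (_%:E); apply: (multiplicative_expR phiD phi0 _ t0).
pose p0 h := fine (P [set w | M h w = 0]).
pose p h (i : 'I_k) := fine (P [set w | M h w = i.+1%:R]).
have eN (i : 'I_k) : e i.+1%:R = expR (- (s * i.+1%:R)) by rewrite /e ger0_norm.
have lb : \sum_(i < k) p h i / h * (1 - e i.+1%:R) @[h --> 0^'+] -->
    \sum_(i < k) lambda i * (1 - expR (- (s * i.+1%:R))).
  apply: cvg_sumr => i; rewrite -eN; apply: cvgM; last exact: cvg_cst.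
  exact: (gcp_jump HM).
have ub : (1 - p0 h) / h - \sum_(i < k) p h i / h * e i.+1%:R @[h --> 0^'+] -->
    \sum_(i < k) lambda i * (1 - expR (- (s * i.+1%:R))).
  have -> : \sum_(i < k) lambda i * (1 - expR (- (s * i.+1%:R))) =
      \sum_(i < k) lambda i - \sum_(i < k) lambda i * e i.+1%:R.
    by rewrite -sumrB; apply: eq_bigr => i _; rewrite eN mulrBr mulr1.
  apply: cvgB; first exact: (gcp_nojump HM).
  apply: cvg_sumr => i; apply: cvgM; last exact: cvg_cst.
  exact: (gcp_jump HM).
apply: (squeeze_cvgr _ lb ub); near=> h.
have h0 : 0 < h by near: h; exact: nbhs_right_gt.
have hV : 0 <= h^-1 by rewrite invr_ge0 ltW.
have phih := phiE h (ltW h0).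
apply/andP; split.
  have -> : \sum_(i < k) p h i / h * (1 - e i.+1%:R) =
      (\sum_(i < k) (1 - e i.+1%:R) * p h i) / h.
    by rewrite mulr_suml; apply: eq_bigr => i _; ring.
  rewrite ler_wpM2r//.
  have := @gcp_atoms_le h (fun x => 1 - e x) (1 - phi h) (ltW h0).
  rewrite /= e00 subrr mul0r add0r; apply.
  - by apply: measurable_funB.
  - by move=> x; rewrite subr_ge0.
  - have := integral_affine2 1 (-1) 0 (eL h (ltW h0)) (eL h (ltW h0)) phih phih.
    rewrite mulN1r mul0r addr0 => <-.
    by apply: eq_integral => w _; rewrite mulN1r mul0r addr0.
have -> : \sum_(i < k) p h i / h * e i.+1%:R = (\sum_(i < k) e i.+1%:R * p h i) / h.
  by rewrite mulr_suml; apply: eq_bigr => i _; ring.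
rewrite -mulrBl ler_wpM2r//.
have := gcp_atoms_le (ltW h0) me e0 phih.
rewrite e00 mul1r -/(p0 h).
have -> : \sum_(i < k) e i.+1%:R * fine (P [set w | M h w = i.+1%:R]) =
  \sum_(i < k) e i.+1%:R * p h i by [].
lra.
Unshelve. all: by end_near. Qed.

Lemma gcp_moments (t : R) : 0 < t ->
  let m := t * \sum_(i < k) lambda i * i.+1%:R in
  let v := t * \sum_(i < k) lambda i * i.+1%:R ^+ 2 in
  (\int[P]_w (`|M t w|)%:E = m%:E)%E /\
  (\int[P]_w (`|M t w| ^+ 2)%:E = (v + m ^+ 2)%:E)%E.
Proof.
move=> t0 m v.
pose G s := t * \sum_(i < k) lambda i * (1 - expR (- (s * i.+1%:R))).
have lim1 (i : 'I_k) : (1 - expR (- (n.+1%:R^-1 * i.+1%:R))) * n.+1%:R @[n --> \oo] -->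
    (i.+1%:R : R).
  have -> : (fun n => (1 - expR (- (n.+1%:R^-1 * i.+1%:R))) * n.+1%:R) =
      (fun n => (1 - expR (- (n.+1%:R^-1 * i.+1%:R))) / (n.+1%:R^-1 : R)).
    by apply/funext => n; rewrite invrK.
  apply: (@cvg_1Bexp R (fun n => n.+1%:R^-1 * i.+1%:R) (fun n => n.+1%:R^-1)) => //.
    exact: cvg_harmonic.
  have -> : (fun n => n.+1%:R^-1 * i.+1%:R / n.+1%:R^-1) = cst (i.+1%:R : R).
    by apply/funext => n /=; rewrite mulrAC divff ?mul1r// invr_eq0 pnatr_eq0.
  exact: cvg_cst.
apply: (@laplace_moments _ _ _ P _ G).
- by apply: measurableT_comp; [exact: normr_measurable|apply: mM; exact: ltW].
- by [].
- by move=> s s0; exact: gcp_laplace.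
- have -> : (fun n => G n.+1%:R^-1 * n.+1%:R) = (fun n => t *
      \sum_(i < k) lambda i * ((1 - expR (- (n.+1%:R^-1 * i.+1%:R))) * n.+1%:R)).
    apply/funext => n; rewrite /G -mulrA mulr_suml.
    by congr (_ * _); apply: eq_bigr => i _; rewrite mulrA.
  apply: cvgM; first exact: cvg_cst.
  by apply: cvg_sumr => i; apply: cvgM => //; exact: cvg_cst.
(* Since [2 (1 - x) - (1 - x^2) = (1 - x)^2], the second difference of [G] is a combination of
   squares of the quotients treated in [lim1]. *)
have -> : (fun n => (2 * G n.+1%:R^-1 - G (2 * n.+1%:R^-1)) * n.+1%:R ^+ 2) =
    (fun n => t * \sum_(i < k) lambda i *
      (((1 - expR (- (n.+1%:R^-1 * i.+1%:R))) * n.+1%:R) ^+ 2)).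
  apply/funext => n; rewrite /G (mulrCA _ t) -mulrBr -mulrA; congr (_ * _).
  rewrite mulr_sumr -sumrB mulr_suml; apply: eq_bigr => i _.
  have -> : - (2 * n.+1%:R^-1 * i.+1%:R) =
    - (n.+1%:R^-1 * i.+1%:R) + - (n.+1%:R^-1 * i.+1%:R) :> R by ring.
  by rewrite expRD; ring.
apply: cvgM; first exact: cvg_cst.
apply: cvg_sumr => i; apply: cvgM; first exact: cvg_cst.
by under eq_fun do rewrite expr2; rewrite expr2; apply: cvgM.
Qed.

End GCP.

(** * Second moments of the generalized Skellam process *)

Section GSP.
Context {d : measure_display} {T : measurableType d} {R : realType}.
Variable P : probability T R.

Lemma Lfun1_ge0 (f : T -> R) (a : R) : measurable_fun [set: T] f -> (forall w, 0 <= f w) ->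
  (\int[P]_w (f w)%:E = a%:E)%E -> f \in Lfun P 1.
Proof.
move=> mf f0 fa; apply/Lfun1_integrable/integrableP; split; first exact/measurable_EFinP.
by under eq_integral do rewrite /= ger0_norm//; rewrite fa ltry.
Qed.

Lemma gcp_moments_ge0 (k : nat) (lambda : 'I_k -> R) (M : R -> T -> R) (t : R) :
  is_gcp P lambda M -> 0 <= t ->
  let m := t * \sum_(i < k) lambda i * i.+1%:R in
  let v := t * \sum_(i < k) lambda i * i.+1%:R ^+ 2 in
  (\int[P]_w (`|M t w|)%:E = m%:E)%E /\
  (\int[P]_w (`|M t w| ^+ 2)%:E = (v + m ^+ 2)%:E)%E.
Proof.
move=> HM; rewrite le_eqVlt => /predU1P[<-|]; last exact: (gcp_moments HM).
have LM := gcp_levy HM; have mM0 := levy_measurable LM (lexx 0).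
rewrite /= !mul0r expr2 mul0r addr0.
have mnM0 : measurable_fun [set: T] (fun w => `|M 0 w|) by exact: measurableT_comp.
split.
- rewrite (@ge0_ae_eq_integral _ _ _ P setT _ (cst 0%E))//.
  + by rewrite integral_cst// mul0e.
  + exact/measurable_EFinP.
  + by apply: filterS (levy_start LM) => w -> _ /=; rewrite normr0.
- rewrite (@ge0_ae_eq_integral _ _ _ P setT _ (cst 0%E))//.
  + by rewrite integral_cst// mul0e.
  + by apply/measurable_EFinP; exact: measurable_funX.
  + by apply: filterS (levy_start LM) => w -> _ /=; rewrite normr0 expr2 mul0r.
Qed.

Variables (k : nat) (lambda mu : 'I_k -> R) (S : R -> T -> R).
Hypothesis HS : is_gsp P lambda mu S.

Lemma gsp_measurable (t : R) : 0 <= t -> measurable_fun [set: T] (S t).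
Proof.
case: HS => [M1 [M2 [HM1 HM2 _ SE]]] t0.
have -> : S t = (fun w => M1 t w - M2 t w) by apply/funext => w; exact: SE.
by apply: measurable_funB; apply: levy_measurable t0; [exact: (gcp_levy HM1)|exact: (gcp_levy HM2)].
Qed.

Lemma gsp_right_continuous (w : T) (t : R) : 0 <= t -> S ^~ w @ t^'+ --> S t w.
Proof.
case: HS => [M1 [M2 [HM1 HM2 _ SE]]] t0.
have [c1 _] := levy_cadlag (gcp_levy HM1) w t0.
have [c2 _] := levy_cadlag (gcp_levy HM2) w t0.
rewrite SE//; apply: cvg_trans (cvgB c1 c2); apply: near_eq_cvg; near=> s.
rewrite SE//; apply: le_trans t0 _; apply: ltW; near: s; exact: nbhs_right_gt.
Unshelve. all: by end_near. Qed.

(** The right side is the variance plus the squared mean of [S t + c]. Both counting processes are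
    replaced by their absolute values, equal to them almost surely, and the square is integrated
    first over [M2], then over [M1]. *)
Lemma gsp_second_moment (t c : R) : 0 <= t ->
  (\int[P]_w ((S t w + c) ^+ 2)%:E =
   (t * (\sum_(i < k) (lambda i + mu i) * i.+1%:R ^+ 2) +
    (t * (\sum_(i < k) (lambda i - mu i) * i.+1%:R) + c) ^+ 2)%:E)%E.
Proof.
case: HS => [M1 [M2 [HM1 HM2 ind SE]]] t0.
have [int1 int12] := gcp_moments_ge0 HM1 t0.
have [int2 int22] := gcp_moments_ge0 HM2 t0.
have mM1 := levy_measurable (gcp_levy HM1) t0.
have mM2 := levy_measurable (gcp_levy HM2) t0.
have mX : measurable_fun [set: T] (fun w => `|M1 t w|) by exact: measurableT_comp.
have mY : measurable_fun [set: T] (fun w => `|M2 t w|) by exact: measurableT_comp.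
have XL := Lfun1_ge0 mX (fun=> normr_ge0 _) int1.
have YL := Lfun1_ge0 mY (fun=> normr_ge0 _) int2.
have X2L := Lfun1_ge0 (measurable_funX 2 mX) (fun=> exprn_ge0 2 (normr_ge0 _)) int12.
have Y2L := Lfun1_ge0 (measurable_funX 2 mY) (fun=> exprn_ge0 2 (normr_ge0 _)) int22.
pose h (z : (R * R)%type) := ((`|z.1| - `|z.2| + c) ^+ 2)%:E.
have mh : measurable_fun setT h.
  apply/measurable_EFinP; apply: measurable_funX; apply: measurable_funD => //.
  by apply: measurable_funB; apply: measurableT_comp.
transitivity (\int[P]_w h (M1 t w, M2 t w))%E.
  apply: ge0_ae_eq_integral => //.
  - apply/measurable_EFinP; apply: measurable_funX; apply: measurable_funD => //.
    exact: gsp_measurable.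
  - by apply: (measurableT_comp mh); exact: measurable_fun_pair.
  - by move=> w _; rewrite lee_fin sqr_ge0.
  - by move=> w _; rewrite lee_fin sqr_ge0.
  apply: filterS2 (gcp_ge0_ae HM1 t0) (gcp_ge0_ae HM2 t0) => w M1p M2p _.
  by rewrite /h SE//= !ger0_norm.
rewrite (indep_integral (h := h) mM1 mM2)//; last 2 first.
- by move=> A B mA mB; apply: ind; exact: process_sigma_measurable.
- by move=> z; rewrite lee_fin sqr_ge0.
set a1 := t * \sum_(i < k) lambda i * i.+1%:R in int1 int12 *.
set b1 := t * \sum_(i < k) mu i * i.+1%:R in int2 int22 *.
set v1 := t * \sum_(i < k) lambda i * i.+1%:R ^+ 2 in int12.
set v2 := t * \sum_(i < k) mu i * i.+1%:R ^+ 2 in int22.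
have inner w : (\int[P]_w' h (M1 t w, M2 t w') =
    ((c ^+ 2 - 2 * c * b1 + (v2 + b1 ^+ 2)) + (2 * c - 2 * b1) * `|M1 t w| +
    1 * `|M1 t w| ^+ 2)%:E)%E.
  transitivity (\int[P]_w' ((`|M1 t w| + c) ^+ 2 + (- 2 * (`|M1 t w| + c)) * `|M2 t w'| +
      1 * `|M2 t w'| ^+ 2)%:E)%E.
    by apply: eq_integral => w' _; congr EFin => /=; ring.
  rewrite (integral_affine2 _ _ _ YL Y2L int2 int22); congr EFin; ring.
under eq_integral do rewrite inner.
rewrite (integral_affine2 _ _ _ XL X2L int1 int12); congr EFin.
have -> : t * \sum_(i < k) (lambda i + mu i) * i.+1%:R ^+ 2 = v1 + v2.
  by rewrite -mulrDr -big_split/=; congr (_ * _); apply: eq_bigr => i _; rewrite mulrDl.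
have -> : t * \sum_(i < k) (lambda i - mu i) * i.+1%:R = a1 - b1.
  by rewrite -mulrBr -sumrB; congr (_ * _); apply: eq_bigr => i _; rewrite mulrBl.
ring.
Qed.

End GSP.

(** * First passage times *)

Section FirstPassage.
Context {d : measure_display} {T : measurableType d} {R : realType}.
Variable D : R -> T -> R.
Hypotheses (mD : forall t : R, 0 <= t -> measurable_fun [set: T] (D t))
  (D_nd : forall (w : T) (s t : R), 0 <= s -> s <= t -> D s w <= D t w).

Let passed u w := [set x : R | 0 <= x /\ u < D x w].

Let passed_lb u w : has_lbound (passed u w).
Proof. by exists 0 => x []. Qed.

Lemma first_passage_ge0 u w : 0 <= first_passage D u w.
Proof.
have [[x Px]|nP] := pselect (passed u w !=set0).
  by apply: lb_le_inf; [exists x|move=> y []].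
by rewrite /first_passage inf_out// => -[].
Qed.

Lemma first_passage_le u w x : 0 <= x -> u < D x w -> first_passage D u w <= x.
Proof. by move=> x0 ux; exact: (ge_inf (passed_lb u w) (conj x0 ux)). Qed.

Lemma lt_first_passage u w x : 0 <= x -> x < first_passage D u w -> D x w <= u.
Proof.
by move=> x0; apply: contraTT; rewrite -!ltNge -leNgt; exact: first_passage_le.
Qed.

(** Non-emptiness excludes the default value [inf set0 = 0], for which the conclusion fails. *)
Lemma first_passage_lt u w x : passed u w !=set0 -> first_passage D u w < x -> 0 <= x ->
  u < D x w.
Proof.
move=> ne /(inf_lt ne)[y [y0 uy] yx] x0.
by apply: lt_le_trans uy _; apply: D_nd => //; exact: ltW.
Qed.

Lemma first_passage_unpassed u w : ~ (passed u w !=set0) -> first_passage D u w = 0.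
Proof. by move=> nP; rewrite /first_passage inf_out// => -[]. Qed.

Lemma measurable_first_passage u : measurable_fun [set: T] (first_passage D u).
Proof.
move=> _; apply: (measurability _ (RGenInftyO.measurableE R)) => //.
move=> _ [_ [x ->] <-]; rewrite setTI.
have [x0|x0] := leP x 0.
  rewrite [X in measurable X](_ : _ = set0)//; apply/seteqP; split => // w /=.
  by rewrite in_itv/= => /lt_le_trans/(_ x0); rewrite ltNge first_passage_ge0.
have mgt q : 0 <= q -> measurable [set w | u < D q w].
  move=> q0; have := measurable_preimage (mD q0) (measurable_itv `]u, +oo[).
  by congr measurable; apply/seteqP; split => w /=; rewrite in_itv/= andbT.
(* For [x > 0], passing before [x] is witnessed at a rational time. The second set is the event that
   level [u] is never passed, where the default value 0 is also below [x]; integer times detect it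
   by monotonicity. *)
rewrite [X in measurable X](_ : _ =
   (\bigcup_(q : rat) (if 0 <= (ratr q : R) < x then [set w | u < D (ratr q) w] else set0))
   `|` (\bigcap_(n : nat) ~` [set w | u < D n%:R w])).
  apply: measurableU.
    apply: bigcupT_measurable_rat => q; case: ifP => // /andP[q0 _]; exact: mgt.
  by apply: bigcapT_measurable => n; apply: measurableC; exact: mgt.
apply/seteqP; split => w /=; rewrite in_itv/=.
  move=> Yx; have [ne|nP] := pselect (passed u w !=set0).
    left; have [q] := rat_in_itvoo Yx.
    rewrite in_itv/= => /andP[Yq qx].
    have q0 : 0 <= ratr q :> R by exact: le_trans (first_passage_ge0 u w) (ltW Yq).
    by exists q => //; rewrite q0 qx/=; exact: first_passage_lt Yq q0.
  by right => n _ /= un; apply: nP; exists n%:R.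
move=> [[q _]|nP].
  case: ifP => // /andP[q0 qx] uq; apply: le_lt_trans qx; exact: first_passage_le.
rewrite first_passage_unpassed// => -[y [y0 uy]].
apply: (nP (Num.truncn y).+1) => //=; apply: lt_le_trans uy _; apply: D_nd => //.
by apply: ltW; exact: truncnS_gt.
Qed.

(** A strict inequality [t < D x w] persists for levels slightly above [t]. Monotonicity is stated
    only near [t] because the default value makes the first passage drop to 0 at levels that a
    bounded path never exceeds. *)
Lemma first_passage_right_continuous (w : T) (t : R) :
  (\forall s \near t^'+, first_passage D t w <= first_passage D s w) /\
  first_passage D ^~ w @ t^'+ --> first_passage D t w.
Proof.
have [ne|nP] := pselect (passed t w !=set0); last first.
  have E : \forall s \near t^'+, first_passage D s w = first_passage D t w.
    near=> s; rewrite !first_passage_unpassed// => -[y [y0 sy]].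
    apply: nP; exists y; split => //; apply: lt_trans sy.
    by near: s; exact: nbhs_right_gt.
  split; first by apply: filterS E => s ->.
  exact: cvg_near_cst E.
have near_passed (x : R) : passed t w x -> \forall s \near t^'+, passed s w x.
  by move=> [x0 tx]; apply: filterS (nbhs_right_lt tx) => s.
have up : \forall s \near t^'+, first_passage D t w <= first_passage D s w.
  have [x Px] := ne; near=> s.
  have Ps : passed s w x by near: s; exact: near_passed.
  apply: lb_le_inf; first by exists x.
  move=> y [y0 sy]; apply: first_passage_le => //; apply: lt_trans sy.
  by near: s; exact: nbhs_right_gt.
split => //; apply/cvgrPdist_lt => e e0.
have [x Px xlt] := inf_adherent e0 (conj ne (passed_lb t w)).
near=> s.
have tYs : first_passage D t w <= first_passage D s w by near: s.
rewrite distrC ger0_norm ?subr_ge0// ltrBlDl; apply: le_lt_trans xlt.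
have [x0 sx] : passed s w x by near: s; exact: near_passed.
exact: first_passage_le.
Unshelve. all: by end_near. Qed.

Lemma right_continuous_time_change (X : R -> T -> R) :
  (forall w (t : R), 0 <= t -> X ^~ w @ t^'+ --> X t w) ->
  forall w (t : R), time_change X (first_passage D) ^~ w @ t^'+ -->
    time_change X (first_passage D) t w.
Proof.
move=> rcX w t A XA.
have XA1 : A (X (first_passage D t w) w).
  have := nbhs_singleton XA; exact.
have [up Ycvg] := first_passage_right_continuous w t.
have rX := rcX w _ (first_passage_ge0 t w) A XA.
(* The first passage may be constant to the right of [t], so the punctured right neighbourhood is
   completed by its endpoint. *)
have {}rX : \forall y \near first_passage D t w, first_passage D t w <= y -> A (X y w).
  move: rX; apply: (@filterS _ (nbhs (first_passage D t w))) => y yA.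
  by rewrite le_eqVlt => /predU1P[<-//|]; exact: yA.
have rY : \forall s \near t^'+, first_passage D t w <= first_passage D s w ->
    A (X (first_passage D s w) w) := Ycvg _ rX.
by apply: (@filterS2 _ (t^'+)) up rY => s ts; exact.
Qed.

End FirstPassage.

(** * Moments of the inverse stable subordinator *)

Section InverseStable.
Context {d : measure_display} {T : measurableType d} {R : realType}.
Variables (P : probability T R) (alpha : R) (D : R -> T -> R).
Hypotheses (alpha01 : 0 < alpha < 1) (HD : stable_subordinator P alpha D).

Let mD (t : R) (t0 : 0 <= t) : measurable_fun [set: T] (D t) :=
  levy_measurable (subord_levy HD) t0.
Let D_nd := subord_nondecreasing HD.
Let D_ge0 := subord_ge0 HD.

Let laplace (s t : R) : 0 < s -> 0 <= t ->
  (\int[P]_w (expR (- (s * D t w)))%:E = (expR (- (t * s `^ alpha)))%:E)%E.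
Proof. by move=> s0 t0; rewrite -(subord_laplace HD s0 t0) unlock. Qed.

Let measurable_laplace (s t : R) : 0 <= t ->
  measurable_fun [set: T] (fun w => expR (- (s * D t w))).
Proof.
move=> t0; apply: measurableT_comp; first exact: measurable_expR.
by apply: measurableT_comp => //; apply: measurable_funM => //; exact: mD.
Qed.

Lemma sum_arith_geom (q : R) (n : nat) : 0 <= q < 1 ->
  \sum_(0 <= i < n) i.+1%:R * q ^+ i <= (1 - q) ^- 2.
Proof.
move=> /andP[q0 q1]; have q1' : 1 - q != 0 by rewrite subr_eq0 gt_eqF.
(* The exact remainder of the series [(1 - q)^-2] is nonnegative. *)
suff -> : \sum_(0 <= i < n) i.+1%:R * q ^+ i =
    (1 - q) ^- 2 - (n%:R / (1 - q) + (1 - q) ^- 2) * q ^+ n.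
  rewrite gerBl mulr_ge0 ?exprn_ge0// addr_ge0// ?invr_ge0 ?exprn_ge0//.
    by rewrite divr_ge0// subr_ge0 ltW.
  by rewrite subr_ge0 ltW.
elim: n => [|n IH]; first by rewrite big_geq// mul0r add0r expr0 mulr1 subrr.
by rewrite big_nat_recr//= IH (exprS q) -natr1; field.
Qed.

(** With [Y] the first passage time, [Y^2] is at most 1 plus the sum of [4 (n+1)] over integers
    [n < Y]. For these [D n <= u], so a factor [exp (1 - s * D n)] with [s = 1 / (1 + u)] is at
    least 1. Integrating leaves the series of [(n+1) q^n] with [q = exp (- s^alpha)]. *)
Lemma inverse_stable_second_moment (u : R) : 0 <= u ->
  (\int[P]_w (first_passage D u w ^+ 2)%:E <=
   (1 + 4 * expR 1 * (2 + u) ^+ 2)%:E)%E.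
Proof.
move=> u0; have u1 : 0 < 1 + u by rewrite ltr_pwDl.
pose s := (1 + u)^-1; have s0 : 0 < s by rewrite invr_gt0.
pose y := s `^ alpha; have y0 : 0 < y by exact: powR_gt0.
pose q := expR (- y).
have q01 : 0 <= q < 1 by rewrite expR_ge0/= -expR0 ltr_expR oppr_lt0.
pose f (n : nat) w : \bar R := ((4 * expR 1 * n.+1%:R) * expR (- (s * D n%:R w)))%:E.
have c0 n : 0 <= 4 * expR 1 * n.+1%:R :> R by rewrite !mulr_ge0// expR_ge0.
have f0 n w : (0 <= f n w)%E by rewrite lee_fin mulr_ge0// expR_ge0.
have mf n : measurable_fun [set: T] (f n).
  by apply/measurable_EFinP; apply: measurable_funM => //; exact: measurable_laplace.
have intf n : (\int[P]_w f n w = ((4 * expR 1 * n.+1%:R) * q ^+ n)%:E)%E.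
  rewrite /f; under eq_integral do rewrite EFinM.
  have mL : measurable_fun [set: T] (fun w => (expR (- (s * D n%:R w)))%:E).
    by apply/measurable_EFinP; exact: measurable_laplace.
  have L0 (w : T) : [set: T] w -> (0 <= (expR (- (s * D n%:R w)))%:E)%E.
    by rewrite lee_fin expR_ge0.
  rewrite (ge0_integralZl_EFin _ _ L0 mL)//.
  by rewrite laplace// -EFinM /q -expRM_natl mulrN.
have mY2 : measurable_fun [set: T] (fun w => (first_passage D u w ^+ 2)%:E).
  by apply/measurable_EFinP; apply: measurable_funX; exact: measurable_first_passage.
have pointwise w : ((first_passage D u w ^+ 2)%:E <= 1 + \sum_(n <oo) f n w)%E.
  set Y := first_passage D u w.
  have Y0 : 0 <= Y by exact: first_passage_ge0.
  pose N := Num.truncn Y.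
  have YN : Y < N.+1%:R by exact: truncnS_gt.
  apply: (@le_trans _ _ (1 + \sum_(0 <= n < N) f n w)%E); last first.
    by rewrite leeD2l// nneseries_lim_ge.
  rewrite sumEFin -EFinD lee_fin.
  (* The sum equals [2 N (N + 1)], and [1 + 2 N (N + 1) >= (N + 1)^2 > Y^2]. *)
  apply: (@le_trans _ _ (1 + \sum_(0 <= n < N) (4 * n.+1%:R))).
    have -> : \sum_(0 <= n < N) (4 * n.+1%:R) = 2 * N%:R * (N%:R + 1) :> R.
      elim: N {YN} => [|N IH]; first by rewrite big_geq// mulr0 mul0r.
      by rewrite big_nat_recr//= IH -natr1; ring.
    rewrite -natr1 in YN; have N0 : 0 <= N%:R :> R by [].
    nra.
  rewrite lerD2l; apply: ler_sum_nat => n /andP[_ nN].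
  have -> : 4 * expR 1 * n.+1%:R * expR (- (s * D n%:R w)) =
    4 * n.+1%:R * (expR 1 * expR (- (s * D n%:R w))) by ring.
  rewrite -[leLHS]mulr1 ler_wpM2l ?mulr_ge0//.
  rewrite -expRD -[leLHS]expR0 ler_expR subr_ge0.
  have nY : n%:R < Y.
    by apply: (@lt_le_trans _ _ N%:R); [rewrite ltr_nat|rewrite truncn_le].
  have Du : D n%:R w <= u by exact: lt_first_passage nY.
  by rewrite /s mulrC ler_pdivrMr// mul1r (le_trans Du)// lerDr.
apply: (@le_trans _ _ (\int[P]_w (1 + \sum_(n <oo) f n w))%E).
  apply: ge0_le_integral => //.
  - by move=> w _; rewrite lee_fin sqr_ge0.
  - apply: emeasurable_funD => //; exact: ge0_emeasurable_sum.
have mser : measurable_fun [set: T] (fun w => \sum_(n <oo) f n w)%E.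
  exact: ge0_emeasurable_sum.
rewrite ge0_integralD//; last by move=> w _; exact: nneseries_ge0.
have int1 : (\int[P]_w 1 = 1)%E by have := expectation_cst P 1; rewrite unlock.
rewrite int1 EFinD leeD2l//.
rewrite integral_nneseries//.
apply: lime_le; first by apply: is_cvg_nneseries => n _ _; exact: integral_ge0.
apply: nearW => n.
under eq_bigr do rewrite intf -mulrA EFinM.
rewrite -ge0_sume_distrr; last by move=> i _; rewrite lee_fin mulr_ge0 ?exprn_ge0 ?expR_ge0.
rewrite sumEFin -EFinM lee_fin ler_wpM2l ?mulr_ge0 ?expR_ge0//.
apply: le_trans (sum_arith_geom n q01) _.
have q1 : 0 < 1 - q by case/andP: q01 => _; rewrite subr_gt0.
rewrite -exprVn lerXn2r ?nnegrE ?invr_ge0 ?(ltW q1) ?addr_ge0//.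
have yV : y^-1 <= 1 + u.
  have -> : y = ((1 + u) `^ alpha)^-1.
    by rewrite /y /s -[X in X `^ _](powR_inv1 (ltW u1)) -powRrM mulN1r powRN.
  rewrite invrK.
  rewrite -[leRHS](powRr1 (ltW u1)) ler_powR ?lerDl//.
  by case/andP: alpha01 => _ /ltW.
(* From here [1 / (1 - q) <= 1 + 1 / y], and [1 / y = (1 + u)^alpha <= 1 + u] explains the factor
   [2 + u]. *)
have qle : q <= (1 + y)^-1.
  rewrite /q expRN lef_pV2 ?posrE ?expR_gt0 ?addr_gt0//; exact: expR_ge1Dx.
have y1 : 0 < 1 + y by rewrite addr_gt0.
apply: (@le_trans _ _ ((1 - (1 + y)^-1)^-1)).
  have : 0 < 1 - (1 + y)^-1 by rewrite subr_gt0 invf_lt1// ltrDl.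
  by move=> ?; rewrite lef_pV2 ?posrE// lerB.
have -> : (1 - (1 + y)^-1)^-1 = 1 + y^-1.
  by field; rewrite !gt_eqF.
lra.
Qed.

(** A zero mean forces the first passage time to vanish almost surely. Then [exp (- D (u/2))] is at
    most [exp (- u)] when level [u] is passed by time [u/2], and at most [exp (u - D x)] otherwise.
    Taking expectations, with Laplace parameter 1, and [x] large contradicts
    [exp (- u) < exp (- u/2)]. *)
Lemma inverse_stable_mean_gt0 (u : R) : 0 < u ->
  (0 < \int[P]_w (first_passage D u w)%:E)%E.
Proof.
move=> u0; rewrite lt_neqAle integral_ge0 ?andbT; last first.
  by move=> w _; rewrite lee_fin first_passage_ge0.
apply/negP => /eqP/esym int0.
have mY : measurable_fun [set: T] (EFin \o first_passage D u).
  by apply/measurable_EFinP; exact: measurable_first_passage.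
have ae0 : ae_eq P setT (EFin \o first_passage D u) (cst 0%E).
  apply/ae_eq_integral_abs => //; rewrite -[RHS]int0; apply: eq_integral => w _.
  by rewrite gee0_abs// lee_fin first_passage_ge0.
(* If Y u = 0 then either D (u / 2) > u, or D stays below u forever. *)
have key (x : R) : 0 <= x ->
    expR (- (u / 2)) <= expR (- u) + expR u * expR (- x).
  move=> x0; have h0 : 0 <= u / 2 by rewrite divr_ge0// ltW.
  have L := laplace ltr01 x0; have Lh := laplace ltr01 h0.
  rewrite powR1 !mulr1 in L Lh.
  rewrite -lee_fin -Lh.
  have eL : (fun w => expR (- (1 * D x w))) \in Lfun P 1.
    apply: (@Lfun1_bounded _ _ _ _ _ 1); first exact: measurable_laplace.
    by move=> w; rewrite ger0_norm ?expR_ge0// -[leRHS]expR0 ler_expR oppr_le0 mul1r D_ge0.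
  have := integral_affine2 (expR (- u)) (expR u) 0 eL eL L L.
  rewrite mul0r addr0 => <-.
  have mleft : measurable_fun [set: T] (fun w => (expR (- (1 * D (u / 2) w)))%:E).
    by apply/measurable_EFinP; exact: measurable_laplace.
  have mright : measurable_fun [set: T] (fun w => (expR (- u) +
      expR u * expR (- (1 * D x w)) + 0 * expR (- (1 * D x w)))%:E).
    apply/measurable_EFinP; apply: measurable_funD; last first.
      by apply: measurable_funM => //; exact: measurable_laplace.
    by apply: measurable_funD => //; apply: measurable_funM => //; exact: measurable_laplace.
  apply: (ae_ge0_le_integral _ _ mleft _ mright) => //.
  apply: filterS ae0 => w /(_ Logic.I) [Y0] _; rewrite lee_fin mul0r addr0 !mul1r.
  have [uD|Du] := ltP u (D (u / 2) w).
    by rewrite -[leLHS]addr0 lerD ?mulr_ge0 ?expR_ge0// ler_expR lerN2 ltW.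
  have Dx : D x w <= u.
    rewrite leNgt; apply/negP => uDx; move: Du; rewrite leNgt => /negP; apply.
    apply: (first_passage_lt D_nd) => //; first by exists x.
    by rewrite Y0 divr_gt0.
  rewrite -expRD -[leLHS]add0r lerD ?expR_ge0// ler_expR.
  have := D_ge0 w h0; lra.
(* [del] is half the gap between the two exponentials, and [x = u - ln del] makes the last term of
   [key] equal to [del]. *)
pose del := (expR (- (u / 2)) - expR (- u)) / 2.
have del0 : 0 < del.
  by rewrite divr_gt0// subr_gt0 ltr_expR; lra.
have del1 : del <= 1.
  have : expR (- (u / 2)) <= 1 by rewrite -[leRHS]expR0 ler_expR; lra.
  have := expR_gt0 (- u); rewrite /del; lra.
have := key (u - ln del); rewrite -expRD.
have -> : u + - (u - ln del) = ln del by ring.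
rewrite lnK ?posrE// => /(_ _)/wrap[]; first by have := ln_le0 del1; lra.
rewrite /del; move: del0; rewrite /del; lra.
Qed.

End InverseStable.

(** * Overdispersion *)

Section Overdispersion.
Context {d : measure_display} {T : measurableType d} {R : realType}.
Variable P : probability T R.

Lemma Lfun2_sqr (f : T -> R) (a : R) : measurable_fun [set: T] f ->
  (\int[P]_w (f w ^+ 2)%:E = a%:E)%E -> f \in Lfun P 2%:E.
Proof.
move=> mf fa; rewrite inE; apply/andP; split; rewrite inE//=.
rewrite /finite_norm unlock poweR_lty//.
under eq_integral => x _ do rewrite /= powR_mulrn// -normrX ger0_norm ?sqr_ge0//.
by rewrite fa ltry.
Qed.

(** Integrate [0 <= (f - a)^2 <= a^2 - 2 a f + g]. Allowing [g] above [f^2] covers a conditional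
    mean against a conditional second moment. *)
Lemma sqr_integral_le (f g : T -> R) (a b : R) : f \in Lfun P 1 -> g \in Lfun P 1 ->
  (forall w, f w ^+ 2 <= g w) ->
  (\int[P]_w (f w)%:E = a%:E)%E -> (\int[P]_w (g w)%:E = b%:E)%E -> a ^+ 2 <= b.
Proof.
move=> fL gL fg fa gb.
have := integral_affine2 (a ^+ 2) (- 2 * a) 1 fL gL fa gb.
have : (0 <= \int[P]_w (a ^+ 2 + - 2 * a * f w + 1 * g w)%:E)%E.
  apply: integral_ge0 => w _; rewrite lee_fin.
  by have := fg w; have := sqr_ge0 (f w - a); nra.
by move=> /[swap] ->; rewrite lee_fin; lra.
Qed.

Lemma ge0_integral_fin (f : T -> R) (a : R) : measurable_fun [set: T] f ->
  (forall w, 0 <= f w) -> (\int[P]_w (f w)%:E <= a%:E)%E ->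
  exists2 b, (\int[P]_w (f w)%:E = b%:E)%E & f \in Lfun P 1.
Proof.
move=> mf f0 fa.
have fb : (\int[P]_w (f w)%:E = (fine (\int[P]_w (f w)%:E))%:E)%E.
  rewrite fineK// ge0_fin_numE; first exact: le_lt_trans fa (ltry _).
  by apply: integral_ge0 => w _; rewrite lee_fin.
exists (fine (\int[P]_w (f w)%:E)) => //; exact: Lfun1_ge0 fb.
Qed.

(** If [D t] vanished almost surely, its Laplace transform at 1 would give [f 1 = 0]. Then
    [exp (- D u)] has mean 1 and is at most 1 for every [u >= 0], so [D u] vanishes almost surely at
    all times, against [subord_nonzero]. *)
Lemma subordinator_non_null (f : R -> R) (D : R -> T -> R) (t : R) :
  levy_subordinator P f D -> 0 < t -> ~ \forall w \ae P, D t w = 0.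
Proof.
move=> HD t0 D0.
have mD (u : R) : 0 <= u -> measurable_fun [set: T] (D u).
  by move=> u0; exact: (levy_measurable (subord_levy HD) u0).
have lap (u : R) : 0 <= u ->
    (\int[P]_w (expR (- (1 * D u w)))%:E = (expR (- (u * f 1)))%:E)%E.
  by move=> u0; rewrite -(subord_laplace HD ltr01 u0) unlock.
have mL (u : R) : 0 <= u -> measurable_fun [set: T] (fun w => expR (- (1 * D u w))).
  move=> u0; apply: measurableT_comp; first exact: measurable_expR.
  by apply: measurableT_comp => //; apply: measurable_funM => //; exact: mD.
have int1 : (\int[P]_w 1 = 1)%E by have := expectation_cst P 1; rewrite unlock.
have eq1 (x : R) : expR x = 1 -> x = 0 by rewrite -[RHS]expR0 => /expR_inj.
have f1 : f 1 = 0.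
  have := lap t (ltW t0); rewrite (@ge0_ae_eq_integral _ _ _ P setT _ (cst 1%E))//.
  - by rewrite int1 => -[/esym/eq1/eqP]; rewrite oppr_eq0 mulf_eq0 gt_eqF//= => /eqP.
  - by apply/measurable_EFinP; apply: mL; exact: ltW.
  - by apply: filterS D0 => w -> _ /=; rewrite mulr0 oppr0 expR0.
have [u u0] := subord_nonzero HD; apply/negP; rewrite -leNgt.
have eL : (fun w => expR (- (1 * D u w))) \in Lfun P 1.
  apply: (@Lfun1_bounded _ _ _ _ _ 1); first exact: mL.
  by move=> w; rewrite ger0_norm ?expR_ge0// -[leRHS]expR0 ler_expR oppr_le0 mul1r (subord_ge0 HD).
have := integral_affine2 1 (-1) 0 eL eL (lap u u0) (lap u u0).
rewrite f1 mulr0 oppr0 expR0 mulr1 mul0r addr0 subrr => int0.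
have m0 : measurable_fun [set: T] (fun w => (1 - 1 * expR (- (1 * D u w)) + 0 * expR (- (1 * D u w)))%:E).
  apply/measurable_EFinP; apply: measurable_funD; last first.
    by apply: measurable_funM => //; exact: mL.
  by apply: measurable_funB => //; apply: measurable_funM => //; exact: mL.
have [N [mN PN0 subN]] : ae_eq P setT (fun w => (1 + -1 * expR (- (1 * D u w)) + 0 * expR (- (1 * D u w)))%:E) (cst 0%E).
  apply/ae_eq_integral_abs => //; first by under eq_fun do rewrite mulNr.
  apply: etrans int0; apply: eq_integral => w _; rewrite gee0_abs// lee_fin mul0r addr0 mulN1r.
  by rewrite subr_ge0 -[leRHS]expR0 ler_expR oppr_le0 mul1r (subord_ge0 HD).
rewrite -PN0; apply: le_measure; rewrite ?inE//.
  have := measurable_preimage (mD _ u0) (measurableC (measurable_set1 (0 : R))).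
  by congr measurable; apply/seteqP; split => w /= /eqP.
move=> w /= /eqP Dw; apply: subN => /= /(_ Logic.I)[]; rewrite mul0r addr0 mulN1r mul1r.
by move=> /eqP; rewrite subr_eq0 eq_sym => /eqP/eq1/eqP; rewrite oppr_eq0 => /eqP.
Qed.

End Overdispersion.

(** * Moments of the fractional process and the final comparison *)

Section GFSP.
Context {d : measure_display} {T : measurableType d} {R : realType}.
Variable P : probability T R.
Variables (k : nat) (lambda mu : 'I_k -> R).

Let v := \sum_(i < k) (lambda i + mu i) * i.+1%:R ^+ 2.
Let m := \sum_(i < k) (lambda i - mu i) * i.+1%:R.

Lemma time_change_second_moment (X Y : R -> T -> R) (u c a b : R) :
  is_gsp P lambda mu X -> independent_processes P X Y ->
  0 <= u -> measurable_fun [set: T] (Y u) -> (forall w, 0 <= Y u w) ->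
  Y u \in Lfun P 1 -> (fun w => Y u w ^+ 2) \in Lfun P 1 ->
  (\int[P]_w (Y u w)%:E = a%:E)%E -> (\int[P]_w (Y u w ^+ 2)%:E = b%:E)%E ->
  (\int[P]_w ((time_change X Y u w + c) ^+ 2)%:E =
   (c ^+ 2 + (v + 2 * c * m) * a + m ^+ 2 * b)%:E)%E.
Proof.
move=> HX ind u0 mY Y0 YL Y2L Ya Yb.
rewrite (time_change_integral (gsp_measurable HX) (gsp_right_continuous HX) u0 mY Y0
  (g := fun x => ((x + c) ^+ 2)%:E) ind).
- rewrite -(integral_affine2 (c ^+ 2) (v + 2 * c * m) (m ^+ 2) YL Y2L Ya Yb).
  apply: eq_integral => w _; rewrite (gsp_second_moment HX)//; congr EFin.
  by rewrite /v /m; ring.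
- by apply/measurable_EFinP; apply: measurable_funX; exact: measurable_funD.
- by move=> x; rewrite lee_fin sqr_ge0.
Qed.

(* [a u] and [b u] are the first two moments of the random time at [u]: the
   inverse stable subordinator, or [u] itself when [alpha = 1]. *)
Lemma gfsp_moments (alpha : R) (X : R -> T -> R) :
  0 < alpha <= 1 -> is_gfsp P lambda mu alpha X ->
  [/\ forall t : R, 0 <= t -> measurable_fun [set: T] (X t),
      forall w (t : R), 0 <= t -> X ^~ w @ t^'+ --> X t w &
      exists a b : R -> R, [/\ measurable_fun setT a /\ measurable_fun setT b,
        forall u, 0 <= a u, forall u, a u ^+ 2 <= b u,
        exists K, forall u : R, 0 <= u -> b u <= K * (2 + u) ^+ 2 &
        (forall u, 0 < u -> 0 < a u) /\
        forall u c : R, 0 <= u -> (\int[P]_w ((X u w + c) ^+ 2)%:E =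
          (c ^+ 2 + (v + 2 * c * m) * a u + m ^+ 2 * b u)%:E)%E]].
Proof.
move=> alpha1 [[_ HS]|[alpha01 [S [D [HS HD ind XE]]]]].
  split; [exact: (gsp_measurable HS)|exact: (gsp_right_continuous HS)|].
  exists (fun u => `|u|), (fun u => u ^+ 2); split => //.
  - by move=> u; rewrite real_normK// num_real.
  - exists 1 => u u0; rewrite mul1r lerXn2r ?nnegrE ?addr_ge0//.
    by rewrite lerDr.
  - split; first by move=> u u0; rewrite normr_gt0 gt_eqF.
    move=> u c u0; rewrite (gsp_second_moment HS)// ger0_norm//; congr EFin.
    by rewrite /v /m; ring.
have mD (t : R) : 0 <= t -> measurable_fun [set: T] (D t).
  by move=> t0; exact: (levy_measurable (subord_levy HD) t0).
have D_nd := subord_nondecreasing HD.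
set Y := first_passage D in ind XE *.
have mY u : measurable_fun [set: T] (Y u) by exact: measurable_first_passage.
have Y0 u w : 0 <= Y u w by exact: first_passage_ge0.
have rcY w (t : R) : 0 <= t -> Y ^~ w @ t^'+ --> Y t w.
  by move=> _; have [] := first_passage_right_continuous D w t.
have mX t : 0 <= t -> measurable_fun [set: T] (X t).
  move=> t0; have -> : X t = time_change S Y t by apply/funext => w; exact: XE.
  exact: (measurable_time_change (gsp_measurable HS) (gsp_right_continuous HS)).
have rcX w (t : R) : 0 <= t -> X ^~ w @ t^'+ --> X t w.
  move=> t0; rewrite XE//.
  have rc := right_continuous_time_change (D := D) (gsp_right_continuous HS) (w := w) (t := t).
  apply: (cvg_trans _ rc).
  apply: near_eq_cvg; near=> s; rewrite XE//; apply: le_trans t0 _; apply: ltW.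
  by near: s; exact: nbhs_right_gt.
(* Absolute values extend both moments to negative arguments, so that measurability and the
   inequalities hold on the whole line. *)
pose a (u : R) : R := fine (\int[P]_w (`|Y `|u| w|%R)%:E).
pose b (u : R) : R := fine (\int[P]_w (Y `|u|%R w ^+ 2)%:E).
have mnY u : measurable_fun [set: T] (fun w => Y u w ^+ 2) by exact: measurable_funX.
have Yb u : 0 <= u -> (\int[P]_w (Y u w ^+ 2)%:E = (b u)%:E)%E /\
    (fun w => Y u w ^+ 2) \in Lfun P 1.
  move=> u0; have [b' intb bL] := ge0_integral_fin (mnY u) (fun=> sqr_ge0 _)
    (inverse_stable_second_moment alpha01 HD u0).
  by split => //; rewrite /b ger0_norm// intb.
have Ya u : 0 <= u -> (\int[P]_w (Y u w)%:E = (a u)%:E)%E /\ Y u \in Lfun P 1.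
  move=> u0; have YL : Y u \in Lfun P 1.
    apply: (Lfun_subset12 (mu := P)); first by rewrite fin_num_measure.
    exact: Lfun2_sqr (Yb u u0).1.
  split => //; rewrite /a ger0_norm//.
  under [in RHS]eq_integral do rewrite ger0_norm//.
  by rewrite fineK//; have := expectation_fin_num YL; rewrite unlock.
have aE u : a u = a `|u| by rewrite /a normr_id.
have bE u : b u = b `|u| by rewrite /b normr_id.
split => //; exists a, b; split.
- split.
    apply: measurableT_comp; first exact: fine_measurable.
    apply: (measurable_integral_right_continuous P (X := Y) (g := fun x => (`|x|%R)%:E)) => //.
    exact/measurable_EFinP.
  apply: measurableT_comp; first exact: fine_measurable.
  apply: (measurable_integral_right_continuous P (X := Y) (g := fun x => (x ^+ 2)%:E)) => //.
    by apply/measurable_EFinP; exact: measurable_funX.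
  by move=> x; rewrite lee_fin sqr_ge0.
- by move=> u; apply: fine_ge0; apply: integral_ge0 => w _; rewrite lee_fin.
- move=> u; rewrite aE bE.
  have [ia La] := Ya _ (normr_ge0 u); have [ib Lb] := Yb _ (normr_ge0 u).
  exact: sqr_integral_le La Lb _ ia ib.
- exists (1 + 4 * expR 1) => u u0; rewrite -lee_fin -(Yb u u0).1.
  apply: le_trans (inverse_stable_second_moment alpha01 HD u0) _.
  have : 1 <= (2 + u) ^+ 2 by rewrite exprn_ege1//; lra.
  by rewrite lee_fin; lra.
split.
  move=> u u0; rewrite -lte_fin -(Ya u (ltW u0)).1.
  exact: (inverse_stable_mean_gt0 HD u0).
move=> u c u0; under eq_integral do rewrite XE//.
exact: time_change_second_moment HS ind u0 (mY u) (Y0 u) (Ya u u0).2 (Yb u u0).2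
  (Ya u u0).1 (Yb u u0).1.
Unshelve. all: by end_near. Qed.

(** With [j = i + 1], the difference is the sum of [lambda_i j (j - 1) + mu_i j (j + 1)]; the [mu]
    part of each term is positive and [k >= 1] provides a term. *)
Lemma gsp_variance_gt_mean : (1 <= k)%N -> (forall i, 0 < lambda i) -> (forall i, 0 < mu i) ->
  m < v.
Proof.
move=> k1 l0 m0; rewrite -subr_gt0 /v /m -sumrB.
have term_gt0 (i : 'I_k) : 0 < (lambda i + mu i) * i.+1%:R ^+ 2 - (lambda i - mu i) * i.+1%:R.
  have i1 : 1 <= i.+1%:R :> R by rewrite ler1n.
  have -> : (lambda i + mu i) * i.+1%:R ^+ 2 - (lambda i - mu i) * i.+1%:R =
    lambda i * (i.+1%:R * (i.+1%:R - 1)) + mu i * (i.+1%:R * (i.+1%:R + 1)) by ring.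
  rewrite ltr_wpDl//; first by rewrite !mulr_ge0 ?subr_ge0// ltW.
  by rewrite !mulr_gt0// addr_gt0.
rewrite (bigD1 (Ordinal k1))//= ltr_pwDl//.
by apply: sumr_ge0 => i _; exact: ltW.
Qed.

End GFSP.

(** Square integrability is part of the conclusion, so that mean and variance are finite and their
    difference is one of real numbers. *)
Theorem mainTheorem19 (d : measure_display) (T : measurableType d)
  (R : realType) (P : probability T R)
  (k : nat) (hk : (1 <= k)%N) (lambda mu : 'I_k -> R)
  (hlambda : forall i, 0 < lambda i) (hmu : forall i, 0 < mu i)
  (alpha : R) (halpha : 0 < alpha <= 1)
  (Sa : R -> T -> R) (hSa : is_gfsp P lambda mu alpha Sa)
  (f : R -> R) (D : R -> T -> R) (hD : levy_subordinator P f D)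
  (hSaD : independent_processes P Sa D)
  (hmom : forall r t : R, 0 < r -> 0 <= t ->
     ('E_P[fun w => (D t w `^ r)%R] < +oo)%E) :
  forall t : R, 0 < t ->
    (time_change Sa D t \in Lfun P 2%:E) /\
    (0 < 'V_P[time_change Sa D t] - 'E_P[time_change Sa D t])%E.
Proof.
move=> t t0; have t0' := ltW t0.
have [mX rcX [a [b [[ma mb] a0 ab [K bK] [apos moment]]]]] := gfsp_moments halpha hSa.
have mvlt := gsp_variance_gt_mean hk hlambda hmu.
set v := \sum_(i < k) (lambda i + mu i) * i.+1%:R ^+ 2 in moment mvlt.
set m := \sum_(i < k) (lambda i - mu i) * i.+1%:R in moment mvlt.
have mD : measurable_fun [set: T] (D t) := levy_measurable (subord_levy hD) t0'.
have D0 w : 0 <= D t w by exact: (subord_ge0 hD).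
set Z := time_change Sa D t.
have mZ : measurable_fun [set: T] Z by exact: measurable_time_change.
have [D2 intD2 D2L] : exists2 D2, (\int[P]_w (D t w ^+ 2)%:E = D2%:E)%E &
    (fun w => D t w ^+ 2) \in Lfun P 1.
  have := hmom 2 t (ltr0Sn _ _) t0'; rewrite unlock.
  under eq_integral do rewrite powR_mulrn//.
  rewrite -ge0_fin_numE; last by apply: integral_ge0 => w _; rewrite lee_fin sqr_ge0.
  move=> /fineK/esym fin; apply: ge0_integral_fin => //; last by rewrite fin.
  - exact: measurable_funX.
  - by move=> w; exact: sqr_ge0.
have DL : D t \in Lfun P 1.
  apply: (Lfun_subset12 (mu := P)); first by rewrite fin_num_measure.
  exact: Lfun2_sqr intD2.
pose D1 := fine (\int[P]_w (D t w)%:E).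
have intD1 : (\int[P]_w (D t w)%:E = D1%:E)%E.
  by rewrite fineK//; have := expectation_fin_num DL; rewrite unlock.
pose A w := a (D t w); pose B w := b (D t w).
have mA : measurable_fun [set: T] A by exact: measurableT_comp.
have mB : measurable_fun [set: T] B by exact: measurableT_comp.
have A0 w : 0 <= A w by exact: a0.
have AB w : A w ^+ 2 <= B w by exact: ab.
have B0 w : 0 <= B w by exact: le_trans (sqr_ge0 _) (AB w).
have [eB intB BL] : exists2 eB, (\int[P]_w (B w)%:E = eB%:E)%E & B \in Lfun P 1.
  (* The bound is the mean of [K (2 + D t)^2], expanded in the moments of [D t]. *)
  apply: (ge0_integral_fin (a := 4 * K + 4 * K * D1 + K * D2)) => //.
  rewrite -(integral_affine2 _ _ _ DL D2L intD1 intD2).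
  apply: ge0_le_integral => //.
  - by move=> w _; rewrite lee_fin.
  - exact/measurable_EFinP.
  - apply/measurable_EFinP; apply: measurable_funD; first apply: measurable_funD => //.
      exact: measurable_funM.
    by apply: measurable_funM => //; exact: measurable_funX.
  - move=> w _; rewrite lee_fin; apply: le_trans (bK _ (D0 w)) _.
    by rewrite le_eqVlt; apply/orP; left; apply/eqP; ring.
have AL : A \in Lfun P 1.
  have m1 : measurable_fun [set: T] (fun w => A w ^+ 2) by exact: measurable_funX.
  have le2 : (\int[P]_w (A w ^+ 2)%:E <= eB%:E)%E.
    rewrite -intB; apply: ge0_le_integral => //.
    - by move=> w _; rewrite lee_fin sqr_ge0.
    - exact/measurable_EFinP.
    - exact/measurable_EFinP.
    - by move=> w _; rewrite lee_fin.
  have [a2 inta2 _] := ge0_integral_fin m1 (fun w => sqr_ge0 (A w)) le2.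
  apply: (Lfun_subset12 (mu := P)); first by rewrite fin_num_measure.
  exact: Lfun2_sqr inta2.
pose eA := fine (\int[P]_w (A w)%:E).
have intA : (\int[P]_w (A w)%:E = eA%:E)%E.
  by rewrite fineK//; have := expectation_fin_num AL; rewrite unlock.
(* Second conditioning: given [D t], the shifted second moment is affine in [A] and [B]. *)
have momZ c : (\int[P]_w ((Z w + c) ^+ 2)%:E =
    (c ^+ 2 + (v + 2 * c * m) * eA + m ^+ 2 * eB)%:E)%E.
  rewrite (time_change_integral mX rcX t0' mD D0 (g := fun x => ((x + c) ^+ 2)%:E) hSaD).
  - rewrite -(integral_affine2 _ _ _ AL BL intA intB).
    by apply: eq_integral => w _; rewrite moment.
  - by apply/measurable_EFinP; apply: measurable_funX; exact: measurable_funD.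
  - by move=> x; rewrite lee_fin sqr_ge0.
have intZ2 : (\int[P]_w (Z w ^+ 2)%:E = (v * eA + m ^+ 2 * eB)%:E)%E.
  have := momZ 0; rewrite mulr0 mul0r addr0 expr2 mul0r add0r => <-.
  by apply: eq_integral => w _; rewrite addr0.
have ZL2 : Z \in Lfun P 2%:E by exact: Lfun2_sqr intZ2.
split => //.
have ZL : Z \in Lfun P 1.
  by apply: (Lfun_subset12 (mu := P)) => //; rewrite fin_num_measure.
have Z2L : (fun w => Z w ^+ 2) \in Lfun P 1.
  by apply: Lfun1_ge0 intZ2 => //; [exact: measurable_funX|move=> w; exact: sqr_ge0].
pose z := fine (\int[P]_w (Z w)%:E).
have intZ : (\int[P]_w (Z w)%:E = z%:E)%E.
  by rewrite fineK//; have := expectation_fin_num ZL; rewrite unlock.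
(* Comparing [momZ 1] with the direct expansion [1 + 2 z + E Z^2] isolates the mean. *)
have zE : z = m * eA.
  have := momZ 1; rewrite (_ : (\int[P]_w ((Z w + 1) ^+ 2)%:E =
     (1 + 2 * z + 1 * (v * eA + m ^+ 2 * eB))%:E)%E); first by case; lra.
  rewrite -(integral_affine2 _ _ _ ZL Z2L intZ intZ2).
  by apply: eq_integral => w _; congr EFin; ring.
have eA0 : 0 < eA.
  rewrite lt_neqAle; apply/andP; split; last first.
    by rewrite -lee_fin -intA; apply: integral_ge0 => w _; rewrite lee_fin.
  (* If [eA] vanished, so would [a (D t)] almost surely, and positivity of [a] at positive times
     would force [D t = 0]. *)
  apply/negP => /eqP eA0; apply: (subordinator_non_null hD t0).
  have : ae_eq P setT (EFin \o A) (cst 0%E).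
    apply/ae_eq_integral_abs => //; first exact/measurable_EFinP.
    transitivity (\int[P]_w (A w)%:E)%E; last by rewrite intA -eA0.
    by apply: eq_integral => w _; rewrite gee0_abs// lee_fin.
  apply: filterS => w /(_ Logic.I)[Aw]; apply/eqP; rewrite eq_le D0 andbT leNgt.
  by apply/negP => /apos; rewrite -/(A w) Aw ltxx.
have eAB : eA ^+ 2 <= eB by exact: sqr_integral_le AL BL AB intA intB.
rewrite varianceE// unlock intZ.
rewrite (_ : (\int[P]_w ((Z ^+ 2)%R w)%:E = (v * eA + m ^+ 2 * eB)%:E)%E)//.
rewrite -EFin_expe -!EFinB lte_fin zE.
(* The quantity to bound is [(v - m) eA + m^2 (eB - eA^2)]. *)
have : 0 < (v - m) * eA by rewrite mulr_gt0// subr_gt0.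
have := mulr_ge0 (sqr_ge0 m) (_ : 0 <= eB - eA ^+ 2); rewrite subr_ge0 => /(_ eAB).
nra.
Qed.
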